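(* Let $0<\epsilon<1$ and $B>0$, and put $$r=\left\lceil\left(\frac{6(B+1)}{\epsilon}\right)^4\right\rceil \text{ in the real case},\qquad r=\left\lceil\left(\frac{6(B+1)}{\epsilon}\right)^8\right\rceil\text{ in the complex case}.$$ Then every unit norm Riesz basic sequence $\{f_i\}_{i\in I}$ ($I$ countable) with upper Riesz bound $B$ in a real (respectively complex) Hilbert space is a union of $r$ $\epsilon$-Riesz basic sequences; that is, $I$ can be partitioned into $r$ (possibly empty) subsets $S_1,\dots,S_r$ with each $\{f_i\}_{i\in S_j}$ an $\epsilon$-Riesz basic sequence.
   Context: A family $\{f_i\}_{i\in I}$ in a Hilbert space is a Riesz basic sequence with lower and upper Riesz bounds $A,B>0$ if $A\sum_{i\in I}|a_i|^2\le\|\sum_{i\in I}a_if_i\|^2\le B\sum_{i\in I}|a_i|^2$ for all (square-summable) scalars $\{a_i\}_{i\in I}$. It is unit norm if $\|f_i\|=1$ for all $i$. A unit norm Riesz basic sequence with Riesz bounds $A=1-\epsilon$, $B=1+\epsilon$ is called an $\epsilon$-Riesz basic sequence. *)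

(* Defs.v *)
From mathcomp Require Export all_boot all_order all_algebra.
From mathcomp Require Export sesquilinear complex.
From mathcomp Require Export boolp classical_sets reals topology normedtype.
From mathcomp Require Export summability.

Set Implicit Arguments.
Unset Strict Implicit.
Unset Printing Implicit Defensive.

Import Order.TTheory GRing.Theory Num.Theory.
Import numFieldNormedType.Exports.

Local Open Scope classical_set_scope.
Local Open Scope ring_scope.

(* [theta] is the conjugation of the scalars: [idfun] for a real Hilbert space,
   [Num.conj] for a complex one. The norm of a normed module over [K] takes its
   values in [K]; in [R[i]], [0 <= x] and [x <= y] mean that [x], respectively
   [y - x], is a nonnegative real. *)
Record hilbertType (K : numFieldType) (theta : K -> K) := HilbertType {
  hilbert_sort :> completeNormedModType K ;
  hilbert_dot : {dot hilbert_sort for theta} ;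
  hilbert_normE : forall x : hilbert_sort, `|x| ^+ 2 = hilbert_dot x x
}.

Section RieszBasicSequences.
Context {K : numFieldType} {V : normedModType K}.

(* Sums over [I] are limits of the net of sums over finite subsets of [I]. *)
Definition has_sum {W : normedModType K} {I : choiceType} (x : I -> W) (s : W) :
  Prop := partial_sum x @ totally --> s.

Definition riesz_basic_sequence {I : choiceType} (f : I -> V) (A B : K) : Prop :=
  [/\ 0 < A, 0 < B &
    forall (a : I -> K) (s : K), has_sum (fun i => `|a i| ^+ 2 : K^o) s ->
      exists2 v : V, has_sum (fun i => a i *: f i) v &
        A * s <= `|v| ^+ 2 <= B * s].

Definition unit_norm {I : choiceType} (f : I -> V) : Prop :=
  forall i, `|f i| = 1.

Definition eps_riesz_basic_sequence {I : choiceType} (f : I -> V) (eps : K) :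
  Prop := unit_norm f /\ riesz_basic_sequence f (1 - eps) (1 + eps).

Definition union_of_eps_riesz {I : choiceType} (f : I -> V) (eps : K) (r : nat) :
  Prop :=
  exists S : 'I_r -> set I,
    [/\ trivIset setT S, \bigcup_j S j = setT &
      forall j, eps_riesz_basic_sequence (fun i : S j => f (val i)) eps].

End RieszBasicSequences.

(* Main.v *)
Require Import Defs.
From mathcomp Require Import perm spectral finmap ring lra.

(* For a Hermitian matrix [T] and disjoint blocks of [r] indices each, let [F] be
   the sum, over all choices of one index in each block, of the characteristic
   polynomials of the principal submatrices on the chosen indices. Processing one
   block at a time, [F] arises from a polynomial of degree [r] in one variable by
   an [(r - 1)]-st derivative, which only sees the mean of the roots; so real
   stability is preserved. Stability makes the quotients that occur below Pick
   functions, hence sums of simple fractions with nonnegative weights, which gives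
   both the interlacing (some choice has its largest root at most that of [F]) and
   the barrier estimate: when the roots [w - y_l] in the current variable satisfy
   [sum_l 1 / y_l <= r / s], the point [w] can be moved down by
   [s * ((r - 1) / r) ^ 2] without increasing the logarithmic derivatives in the
   other variables. Applied to [r] copies of [G - 1] and of [1 - G], where [G] is
   a Gram matrix, this colours every finite subfamily with [r ^ 2] colours; an
   ultrafilter on the finite subsets of the index set gives the infinite case. *)

Set Implicit Arguments.
Unset Strict Implicit.
Unset Printing Implicit Defensive.

Import Order.TTheory GRing.Theory Num.Theory.
Import numFieldNormedType.Exports.

Local Open Scope ring_scope.

(** * Principal minors and their block sums *)

(** A bound on the largest root bounds a quadratic form from above only, which is why [G - 1] and
    [1 - G] are coloured separately and pairs of colours are used. Choosing one of the [r] copies of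
    each index amounts to colouring it, and the selected principal submatrix is the direct sum of
    the compressions to the colour classes. Unit norm makes the diagonal of [T] zero: at a point [w]
    of order [B / eps], the diagonal entries of the inverse of [w - T] are then below [1 / s] with
    [w - s = eps / 2], so a descent by almost [s] ends near 0. The descent falls short of [s] by at
    most [2 * s / r], whence [r] of order [B / eps ^+ 2], and the pairs of colours square this
    number. One obstacle is that stability concerns the open half-plane while the barrier lives at
    real points; limits are taken algebraically, along polynomials in one real parameter. *)

Section Minors.
Variables (K : comNzRingType) (N : nat).
Implicit Types (T : 'M[K]_N) (z : 'I_N -> K) (Y : {set 'I_N}).

(* The rows outside [Y] are those of the identity, so that the determinant is the
   principal minor on [Y] of [diag(z) - T], without matrices of varying size. *)
Definition minor_mx T z Y : 'M[K]_N :=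
  \matrix_(i, j) if i \in Y then (z i *+ (i == j) - T i j) else (i == j)%:R.

Definition minor T z Y : K := \det (minor_mx T z Y).

Definition upd z (k : 'I_N) (t : K) : 'I_N -> K :=
  fun i => if i == k then t else z i.

(* [P] lists the blocks of indices from which one index each is still to be added
   to [Y]. *)
Fixpoint mixed T z (P : seq (seq 'I_N)) (Y : {set 'I_N}) : K :=
  if P is b :: P' then \sum_(k <- b) mixed T z P' (k |: Y) else minor T z Y.

Lemma eq_minor T z1 z2 Y : {in Y, z1 =1 z2} -> minor T z1 Y = minor T z2 Y.
Proof.
move=> e; congr (\det _); apply/matrixP => i j; rewrite !mxE.
by case: ifP => // iY; rewrite e.
Qed.

Lemma eq_mixed T z1 z2 P Y :
  {in Y, z1 =1 z2} -> {in flatten P, z1 =1 z2} -> mixed T z1 P Y = mixed T z2 P Y.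
Proof.
elim: P Y => [|b P IH] Y eY eP /=; first exact: eq_minor.
rewrite !big_seq; apply: eq_bigr => k kb; apply: IH => i.
  by rewrite in_setU1 => /predU1P[->|/eY//]; apply: eP; rewrite /= mem_cat kb.
by move=> iP; apply: eP; rewrite /= mem_cat iP orbT.
Qed.

(** Row [k] splits into [z k] times the identity row and the row for [z k = 0]; with the identity
    row in place the matrix is that of [Y], thanks to the encoding of [minor_mx]. *)
Lemma minor_affine T z Y k : k \notin Y ->
  minor T z (k |: Y) = z k * minor T z Y + minor T (upd z k 0) (k |: Y).
Proof.
move=> kY; rewrite -[minor T (upd z k 0) _]mul1r /minor.
apply: (@determinant_multilinear _ _ _ _ _ k).
- apply/rowP => j; rewrite !mxE /upd in_setU1 eqxx /= (negPf kY) mul0rn !add0r.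
  by rewrite mulr_natr mul1r.
- apply/matrixP => i j; have ik := negPf (neq_lift k i).
  by rewrite !mxE in_setU1 [lift k i == k]eq_sym ik.
- apply/matrixP => i j; have ik := negPf (neq_lift k i).
  by rewrite !mxE in_setU1 /upd [lift k i == k]eq_sym ik.
Qed.

Lemma mixed_upd T z P Y k t :
  k \notin Y -> k \notin flatten P -> mixed T (upd z k t) P Y = mixed T z P Y.
Proof.
by move=> kY kP; apply: eq_mixed => i iX; rewrite /upd; case: eqP => // ik;
  move: iX; rewrite ik (negPf kY, negPf kP).
Qed.

Lemma mixed_affine T z P Y k : k \notin Y -> k \notin flatten P ->
  mixed T z P (k |: Y) = z k * mixed T z P Y + mixed T (upd z k 0) P (k |: Y).
Proof.
elim: P Y => [|b P IH] Y kY; first by move=> _; exact: minor_affine.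
rewrite /= mem_cat negb_or => /andP[kb kP].
rewrite mulr_sumr -big_split /= !big_seq; apply: eq_bigr => l lb.
rewrite finset.setUCA IH // in_setU1 negb_or kY andbT.
by apply: contra kb => /eqP->.
Qed.

End Minors.

Lemma rmorph_mixed (K K' : comNzRingType) (f : {rmorphism K -> K'}) N
    (T : 'M[K]_N) z P Y :
  f (mixed T z P Y) = mixed (map_mx f T) (f \o z) P Y.
Proof.
elim: P Y => [|b P IH] Y /=.
  rewrite /minor -det_map_mx; congr (\det _); apply/matrixP => i j.
  by rewrite !mxE; case: ifP => _; rewrite ?rmorphB ?rmorphMn ?rmorph1.
by rewrite rmorph_sum; apply: eq_bigr => k _; exact: IH.
Qed.

(** Transposition does not preserve the shape of [minor_mx], so both determinants are compared with
    that of [S]: in the Leibniz sum a permutation contributes only if it fixes every index outside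
    [Y], and then the rows in [Y] meet only columns in [Y]. *)
Lemma minor_tr (K : comNzRingType) N (T : 'M[K]_N) z Y :
  minor T^T z Y = minor T z Y.
Proof.
pose S := \matrix_(i, j) (if (i \in Y) && (j \in Y)
   then (z i *+ (i == j) - T i j) else (i == j)%:R).
suff H (U W : 'M[K]_N) : (forall i j, i \in Y -> j \in Y -> W i j = z i *+ (i == j) - U i j) ->
   (forall i j, ~~ ((i \in Y) && (j \in Y)) -> W i j = (i == j)%:R) ->
   minor U z Y = \det W.
  rewrite (H T S) ?(H T^T S^T) ?det_tr // => i j; rewrite !mxE.
  - by move=> -> ->; rewrite eq_sym; case: eqP => [->|].
  - by rewrite andbC eq_sym => /negPf->.
  - by move=> -> ->.
  - by move=> /negPf->.
move=> WY WN; apply: eq_bigr => s _; congr (_ * _).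
have [sY|] := boolP [forall i, (i \notin Y) ==> (s i == i)].
  have sC i : i \notin Y -> s i = i by move/(implyP (forallP sY i))/eqP.
  apply: eq_bigr => i _; rewrite !mxE; case: ifP => iY; last first.
    by rewrite WN // iY.
  rewrite WY //; apply: contraT => sN.
  by move/sC: (sN) => /perm_inj si; rewrite si iY in sN.
case/fintype.forallPn => i; rewrite negb_imply => /andP[iY /negPf si].
by rewrite (bigD1 i) //= [RHS](bigD1 i) //= !mxE (negPf iY) WN ?(negPf iY) //
  eq_sym si !mul0r.
Qed.

Lemma mixed_tr (K : comNzRingType) N (T : 'M[K]_N) z P Y :
  mixed T^T z P Y = mixed T z P Y.
Proof.
elim: P Y => [|b P IH] Y /=; first exact: minor_tr.
by apply: eq_bigr => k _; exact: IH.
Qed.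

Section BlockPolynomial.
Variables (K : comNzRingType) (N : nat) (T : 'M[K]_N) (P : seq (seq 'I_N)).
Implicit Types (z : 'I_N -> K) (Y : {set 'I_N}) (b : seq 'I_N).

Definition updX z b : 'I_N -> {poly K} :=
  fun i => if i \in b then 'X else (z i)%:P.

Definition upds z b (t : K) : 'I_N -> K := fun i => if i \in b then t else z i.

(** The whole block is added at once, with a common variable. The sum over choices of one index of
    the block is read off the two top coefficients, see [mixed_cons]. *)
Definition bpoly b z Y : {poly K} :=
  mixed (map_mx polyC T) (updX z b) P ([set i in b] :|: Y).

Lemma horner_mixed (u : 'I_N -> {poly K}) Y t :
  (mixed (map_mx polyC T) u P Y).[t] = mixed T (fun i => (u i).[t]) P Y.
Proof.
rewrite -[LHS]/(horner_eval t _) rmorph_mixed.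
have -> : map_mx (horner_eval t) (map_mx polyC T) = T.
  by apply/matrixP => i j; rewrite !mxE /horner_eval hornerC.
exact: eq_mixed.
Qed.

Lemma horner_bpoly b z Y t :
  (bpoly b z Y).[t] = mixed T (upds z b t) P ([set i in b] :|: Y).
Proof.
by rewrite horner_mixed; apply: eq_mixed => i _; rewrite /updX /upds;
  case: ifP; rewrite ?hornerX ?hornerC.
Qed.

Lemma bpoly_nil z Y : bpoly [::] z Y = (mixed T z P Y)%:P.
Proof.
rewrite /bpoly rmorph_mixed; suff -> : [set i in [::]] :|: Y = Y by exact: eq_mixed.
by apply/setP => i; rewrite !inE.
Qed.

Lemma bpoly_cons k b z Y :
  k \notin b -> k \notin Y -> k \notin flatten P ->
  bpoly (k :: b) z Y = 'X * bpoly b z Y + bpoly b (upd z k 0) (k |: Y).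
Proof.
move=> kb kY kP; rewrite /bpoly.
have -> : [set i in k :: b] :|: Y = k |: ([set i in b] :|: Y).
  by apply/setP => i; rewrite !inE orbA.
rewrite mixed_affine //; last by rewrite !inE negb_or kb.
rewrite {1}/updX mem_head; congr ('X * _ + _).
  have ne i : i != k -> updX z (k :: b) i = updX z b i.
    by rewrite /updX inE => /negPf->.
  apply: eq_mixed => i iX; apply: ne; apply: contraTneq iX => -> //.
  by rewrite !inE negb_or kb.
have -> : [set i in b] :|: (k |: Y) = k |: ([set i in b] :|: Y).
  by rewrite finset.setUCA.
by apply: eq_mixed => i _; rewrite /upd /updX inE;
  have [->|//] := eqVneq i k; rewrite (negPf kb).
Qed.

Lemma size_bpoly b z Y :
  uniq b -> all (fun k => (k \notin Y) && (k \notin flatten P)) b ->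
  (size (bpoly b z Y) <= (size b).+1)%N.
Proof.
elim: b z Y => [|k b IH] z Y; first by rewrite bpoly_nil size_polyC; case: eqP.
move=> /andP[kb ub] /= /andP[/andP[kY kP] bY].
rewrite bpoly_cons //; apply: (leq_trans (size_polyD _ _)); rewrite geq_max.
apply/andP; split.
  rewrite mulrC; apply: (leq_trans (size_polyMleq _ _)).
  by rewrite size_polyX addn2 /= ltnS IH.
apply: leqW; apply: IH => //; apply/allP => i ib.
move/allP/(_ i ib): bY => /andP[iY ->]; rewrite in_setU1 negb_or iY !andbT.
by apply: contraNneq kb => <-.
Qed.

Lemma coef_bpoly b z Y :
  uniq b -> all (fun k => (k \notin Y) && (k \notin flatten P)) b ->
  (bpoly b z Y)`_(size b) = mixed T z P Y.
Proof.
elim: b z Y => [|k b IH] z Y; first by rewrite bpoly_nil coefC.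
move=> /andP[kb ub] /= /andP[/andP[kY kP] bY].
rewrite bpoly_cons // coefD coefXM /= IH // [X in _ + X]nth_default ?addr0 //.
apply: size_bpoly => //; apply/allP => i ib.
move/allP/(_ i ib): bY => /andP[iY ->]; rewrite in_setU1 negb_or iY !andbT.
by apply: contraNneq kb => <-.
Qed.

Lemma coef_bpoly_pred b z Y : (0 < size b)%N ->
  uniq b -> all (fun k => (k \notin Y) && (k \notin flatten P)) b ->
  (bpoly b z Y)`_(size b).-1 = \sum_(k <- b) mixed T (upd z k 0) P (k |: Y).
Proof.
elim: b z Y => [|k b IH] z Y // _.
move=> /andP[kb ub] /= /andP[/andP[kY kP] bY].
have bkY : all (fun i => (i \notin k |: Y) && (i \notin flatten P)) b.
  apply/allP => i ib; move/allP/(_ i ib): bY => /andP[iY ->].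
  rewrite in_setU1 negb_or iY !andbT; by apply: contraNneq kb => <-.
rewrite bpoly_cons // coefD coefXM big_cons coef_bpoly // addrC; congr (_ + _).
case: b IH kb ub bY bkY => [|l b] IH kb ub bY bkY; first by rewrite big_nil.
by rewrite /= IH.
Qed.

(** Chain rule for a function affine in each of the variables that were identified: differentiating
    in one of them deletes its index. *)
Lemma deriv_bpoly b z Y :
  uniq b -> all (fun k => (k \notin Y) && (k \notin flatten P)) b ->
  (bpoly b z Y)^`() =
    \sum_(k <- b) mixed (map_mx polyC T) (updX z b) P ([set i in b] :\ k :|: Y).
Proof.
elim: b z Y => [|k b IH] z Y; first by rewrite bpoly_nil derivC big_nil.
move=> /andP[kb ub] /= /andP[/andP[kY kP] bY].
have bkY : all (fun i => (i \notin k |: Y) && (i \notin flatten P)) b.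
  apply/allP => i ib; move/allP/(_ i ib): bY => /andP[iY ->].
  rewrite in_setU1 negb_or iY !andbT; by apply: contraNneq kb => <-.
have ne i : i != k -> updX z (k :: b) i = updX z b i.
  by rewrite /updX inE => /negPf->.
rewrite bpoly_cons // derivD derivM derivX mul1r big_cons -addrA; congr (_ + _).
  have -> : [set i in k :: b] :\ k :|: Y = [set i in b] :|: Y.
    apply/setP => i; rewrite !inE; case: eqP => [->|//].
    by rewrite (negPf kb) (negPf kY).
  apply: eq_mixed => i iX; apply/esym/ne; apply: contraTneq iX => -> //.
  by rewrite !inE negb_or kb.
rewrite IH // IH // mulr_sumr -big_split /= !big_seq; apply: eq_bigr => l lb.
have lk : l != k by apply: contraNneq kb => <-.
have -> : [set i in k :: b] :\ l :|: Y = k |: ([set i in b] :\ l :|: Y).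
  apply/setP => i; rewrite !inE; case: (i =P k) => [->|//].
  by rewrite eq_sym lk.
rewrite mixed_affine //; last by rewrite !inE (negPf kb) andbF.
rewrite {3}/updX mem_head; congr ('X * _ + _).
  apply: eq_mixed => i iX; apply/esym/ne; apply: contraTneq iX => -> //.
  by rewrite !inE (negPf kb) andbF.
have -> : [set i in b] :\ l :|: (k |: Y) = k |: ([set i in b] :\ l :|: Y).
  by rewrite finset.setUCA.
by apply: eq_mixed => i _; rewrite /upd /updX inE;
  have [->|//] := eqVneq i k; rewrite (negPf kb).
Qed.

End BlockPolynomial.

(** * Stability *)

Section Stability.
Variables (C : numClosedFieldType).

Definition qform N (T : 'M[C]_N) (v : 'I_N -> C) : C :=
  \sum_i \sum_j (v i)^* * T i j * v j.

Definition hermitian_mx N (T : 'M[C]_N) := map_mx Num.conj T = T^T.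

Lemma hermitianE N (T : 'M[C]_N) i j : hermitian_mx T -> (T i j)^* = T j i.
Proof. by move=> /matrixP/(_ i j); rewrite !mxE. Qed.

Lemma qform_real N (T : 'M[C]_N) v : hermitian_mx T -> qform T v \is Num.real.
Proof.
move=> hT; apply/CrealP; rewrite /qform rmorph_sum exchange_big /=.
apply: eq_bigr => j _; rewrite rmorph_sum; apply: eq_bigr => i _ /=.
by rewrite !rmorphM /= conjCK hermitianE //; ring.
Qed.

Lemma conj_mixed N (T : 'M[C]_N) z P Y : hermitian_mx T ->
  (mixed T z P Y)^* = mixed T (fun i => (z i)^*) P Y.
Proof. by move=> hT; rewrite rmorph_mixed hT mixed_tr. Qed.

Lemma mixed_real N (T : 'M[C]_N) z P Y : hermitian_mx T ->
  (forall i, z i \is Num.real) -> mixed T z P Y \is Num.real.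
Proof.
move=> hT zr; apply/CrealP; rewrite conj_mixed //.
by apply: eq_mixed => i _; exact: conj_Creal.
Qed.

(** A singular matrix has a kernel vector; the identity rows force it to vanish outside [Y], and
    pairing the remaining rows with its conjugate gives the identity. *)
Lemma minor_kernel N (T : 'M[C]_N) z Y : minor T z Y = 0 ->
  exists v : 'I_N -> C, [/\ exists i, v i != 0, forall i, i \notin Y -> v i = 0 &
    \sum_i z i * `|v i| ^+ 2 = qform T v].
Proof.
rewrite /minor -det_tr => /eqP/det0P[w w0 wM].
have wE i : \sum_j w 0 j * minor_mx T z Y i j = 0.
  have /rowP/(_ i) := wM; rewrite !mxE => e; rewrite -[RHS]e.
  by apply: eq_bigr => j _; rewrite [in RHS]mxE.
have wY i : i \notin Y -> w 0 i = 0.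
  move=> iY; have := wE i; rewrite (bigD1 i) //= big1 => [|j ji]; last first.
    by rewrite mxE (negPf iY) eq_sym (negPf ji) mulr0.
  by rewrite mxE (negPf iY) eqxx mulr1 addr0.
exists (w 0); split=> //.
  apply/existsP; apply: contraNT w0; rewrite negb_exists => /forallP w0.
  by apply/eqP/rowP => i; rewrite mxE; apply/eqP; have := w0 i; rewrite negbK.
apply: eq_bigr => i _; have [iY|iY] := boolP (i \in Y); last first.
  by rewrite wY // normr0 expr0n mulr0 big1 // => j _; rewrite conjC0 !mul0r.
have := wE i; under eq_bigr => j _ do rewrite mxE iY mulrBr.
rewrite sumrB (bigD1 i) //= big1 => [|j ji]; last first.
  by rewrite eq_sym (negPf ji) mulr0n mulr0.
rewrite eqxx mulr1n addr0 => /eqP; rewrite subr_eq0 => /eqP e.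
rewrite normCK mulrA [z i * _]mulrC e mulr_suml.
by apply: eq_bigr => j _; ring.
Qed.

(** Imaginary parts in [minor_kernel]: the form is real, while the other side would have a positive
    imaginary part. *)
Lemma minor_stable N (T : 'M[C]_N) z (Y : {set 'I_N}) : hermitian_mx T ->
  {in Y, forall i, 0 < 'Im (z i)} -> minor T z Y != 0.
Proof.
move=> hT zH; apply/eqP => /minor_kernel[v [[k vk] vY e]].
have : 'Im (\sum_i z i * `|v i| ^+ 2) = 0 by rewrite e; apply/Creal_ImP/qform_real.
have rv i : `|v i| ^+ 2 \is Num.real by rewrite realX // normr_real.
rewrite raddf_sum /=; under eq_bigr => i _ do rewrite ImMr //.
have ge0 i : true -> 0 <= 'Im (z i) * `|v i| ^+ 2.
  move=> _; have [iY|/vY->] := boolP (i \in Y); last by rewrite normr0 expr0n mulr0.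
  by rewrite mulr_ge0 ?exprn_ge0 // ltW // zH.
move=> /eqP; rewrite psumr_eq0 // => /allP/(_ k (mem_index_enum _)) /=.
have kY : k \in Y by apply: contraT => /vY/eqP; rewrite (negPf vk).
by rewrite mulf_eq0 gt_eqF ?zH //= expf_eq0 /= normr_eq0 (negPf vk).
Qed.

(** Up to the leading coefficient this is [r * t] minus the sum of the roots, none of which has a
    positive imaginary part. *)
Lemma roots_mean (g : {poly C}) r (t : C) :
  (0 < r)%N -> (size g <= r.+1)%N -> g`_r != 0 ->
  (forall x, 0 < 'Im x -> ~~ root g x) -> 0 < 'Im t ->
  t * g`_r *+ r + g`_r.-1 != 0.
Proof.
move=> r0 sg gr gH tH; have [rs grs] := closed_field_poly_normal g.
have sge : size g = r.+1.
  by apply/eqP; rewrite eqn_leq sg ltnNge; apply: contra gr => /leq_sizeP->.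
have lg : lead_coef g = g`_r by rewrite lead_coefE sge.
have srs : size rs = r.
  have := sge; rewrite grs size_scale ?size_prod_XsubC ?lg //; by case.
have cE : g`_r.-1 = - (g`_r * \sum_(x <- rs) x).
  have := @coefPn_prod_XsubC _ rs; rewrite srs -lt0n => /(_ r0) cp.
  by rewrite [in LHS]grs coefZ lg cp mulrN.
rewrite cE -mulrnAl -[t *+ r]mulr_natr mulrC -mulrBr mulf_neq0 //.
have rsH : all (fun x => 'Im x <= 0) rs.
  apply/allP => x xrs; rewrite real_leNgt ?real0 ?Creal_Im //; apply/negP => xH.
  have := gH x xH; rewrite grs rootZ ?lg // root_prod_XsubC xrs //.
apply/eqP => /(congr1 (fun x => 'Im x)); rewrite raddf0 raddfB /= ImMr ?realn //.
apply/eqP; rewrite gt_eqF // subr_gt0; apply: (@le_lt_trans _ _ 0); last first.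
  by rewrite mulr_gt0 // ltr0n.
rewrite raddf_sum /= -oppr_ge0 -sumrN big_seq.
by apply: sumr_ge0 => x /(allP rsH); rewrite oppr_ge0.
Qed.

Definition well_blocked N (P : seq (seq 'I_N)) (Y : {set 'I_N}) :=
  [&& uniq (flatten P), all (fun b => 0 < size b)%N P
    & all (fun i => i \notin Y) (flatten P)].

Definition block_const N (P : seq (seq 'I_N)) (z : 'I_N -> C) :=
  {in P, forall b, {in b &, forall i j, z i = z j}}.

Lemma mixed_cons N (T : 'M[C]_N) z b P (Y : {set 'I_N}) t :
  (0 < size b)%N -> {in b, forall i, z i = t} -> uniq b ->
  all (fun k => (k \notin Y) && (k \notin flatten P)) b ->
  mixed T z (b :: P) Y = t * (bpoly T P b z Y)`_(size b) *+ size b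
    + (bpoly T P b z Y)`_(size b).-1.
Proof.
move=> b0 bt ub bY; rewrite coef_bpoly // coef_bpoly_pred //=.
rewrite -(count_predT b) -iter_addr_0 -big_const_seq -big_split /= !big_seq; apply: eq_bigr => k kb.
by have /andP[kY kP] := allP bY k kb; rewrite mixed_affine // bt.
Qed.

Lemma well_blocked_cons N (b : seq 'I_N) P Y :
  well_blocked (b :: P) Y -> [/\ (0 < size b)%N, uniq b,
    all (fun k => (k \notin Y) && (k \notin flatten P)) b &
    forall B : {set 'I_N}, B \subset [set i in b] -> well_blocked P (B :|: Y)].
Proof.
rewrite /well_blocked /= cat_uniq all_cat => /and3P[/and3P[ub hbP uP] /andP[b0 P0]].
move=> /andP[bY PY]; split=> //.
  apply/allP => k kb; rewrite (allP bY) //=; apply: contra hbP => kP.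
  by apply/hasP; exists k.
move=> B Bb; rewrite uP P0 /=; apply/allP => k kP; rewrite finset.in_setU negb_or.
rewrite (allP PY) // andbT; apply: contra hbP => kB; apply/hasP; exists k => //.
by have := fintype.subsetP Bb k kB; rewrite inE.
Qed.

(** Induction over the blocks: with [b] moved into the set, [bpoly] has no root in the upper
    half-plane by the induction hypothesis, and [roots_mean] passes to the sum over single
    choices. *)
Lemma mixed_stable N (T : 'M[C]_N) z P (Y : {set 'I_N}) : hermitian_mx T ->
  well_blocked P Y -> block_const P z ->
  {in Y, forall i, 0 < 'Im (z i)} -> {in flatten P, forall i, 0 < 'Im (z i)} ->
  mixed T z P Y != 0.
Proof.
move=> hT; elim: P z Y => [|b P IH] z Y wb zc zY zP; first exact: minor_stable.
have [b0 ub bY wbP] := well_blocked_cons wb.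
have wbY : well_blocked P Y by have := wbP finset.set0 (finset.sub0set _); rewrite finset.set0U.
have zcP : block_const P z by move=> c cP; apply: zc; rewrite inE cP orbT.
have zPP : {in flatten P, forall i, 0 < 'Im (z i)}.
  by move=> i iP; apply: zP; rewrite /= mem_cat iP orbT.
have [i0 i0b] : exists i, i \in b by case: (b) b0 => // i c _; exists i; rewrite mem_head.
have i0H : 0 < 'Im (z i0) by apply: zP; rewrite /= mem_cat i0b.
rewrite (@mixed_cons _ _ _ _ _ _ (z i0)) //; last first.
  by move=> i ib; apply: (zc b _ i i0 ib i0b); rewrite mem_head.
apply: roots_mean => //; first exact: size_bpoly.
  by rewrite coef_bpoly //; apply: IH.
move=> x xH; rewrite /root horner_bpoly.
have zb i : i \notin b -> upds z b x i = z i by rewrite /upds => /negPf->.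
have bP i : i \in flatten P -> i \notin b.
  by move=> iP; apply/negP => /(allP bY); rewrite iP andbF.
apply: IH.
- exact: wbP.
- move=> c cP i j ic jc; rewrite !zb ?bP //; first exact: (zcP c).
  + by apply/flattenP; exists c.
  + by apply/flattenP; exists c.
- move=> i; rewrite !inE /upds; case: ifP => // _ /= iY; exact: zY.
- by move=> i iP; rewrite zb ?bP // zPP.
Qed.

(* [mixed_affine] writes the quotient below as [z k] plus a number whose
   imaginary part is nonnegative by stability in the variable [z k]. *)
Lemma mixed_quotient N (T : 'M[C]_N) z P (Y : {set 'I_N}) k : hermitian_mx T ->
  well_blocked P (k |: Y) -> k \notin Y -> block_const P z ->
  {in k |: Y, forall i, 0 < 'Im (z i)} -> {in flatten P, forall i, 0 < 'Im (z i)} ->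
  0 <= 'Im (mixed T (upd z k 0) P (k |: Y) / mixed T z P Y).
Proof.
move=> hT wb kY zc zY zP.
have kP : k \notin flatten P.
  have /and3P[_ _ /allP PY] := wb; apply/negP => /PY; by rewrite setU11.
have wbY : well_blocked P Y.
  have /and3P[h1 h2 /allP PY] := wb; rewrite /well_blocked h1 h2 /=.
  by apply/allP => i /PY; rewrite in_setU1 negb_or => /andP[].
have n0 : mixed T z P Y != 0.
  apply: mixed_stable => // i iY; apply: zY; by rewrite in_setU1 iY orbT.
set E := mixed T _ _ _; set F := mixed T _ _ _ in n0 *.
rewrite real_leNgt ?real0 ?Creal_Im //; apply/negP => EF.
have : mixed T (upd z k (- (E / F))) P (k |: Y) != 0.
  have ne i : i != k -> upd z k (- (E / F)) i = z i by rewrite /upd => /negPf->.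
  have nP i : i \in flatten P -> i != k by apply: contraTneq => ->.
  apply: mixed_stable => //.
  - move=> c cP i j ic jc; rewrite !ne; first exact: (zc c).
    + by apply: nP; apply/flattenP; exists c.
    + by apply: nP; apply/flattenP; exists c.
  - move=> i iY; rewrite /upd; case: eqP => _; last exact: zY.
    by rewrite raddfN /= oppr_gt0.
  - by move=> i iP; rewrite ne ?nP // zP.
rewrite mixed_affine // mixed_upd // {1}/upd eqxx -/F mulNr divfK //.
suff -> : mixed T (upd (upd z k (- (E / F))) k 0) P (k |: Y) = E.
  by rewrite addNr eqxx.
by apply: eq_mixed => i _; rewrite /upd; case: eqP.
Qed.

End Stability.

(** * Partial fractions *)

Section PartialFractions.
Variables (C : numClosedFieldType).

(** A limit at 0 obtained algebraically: [p.[e] = p.[0] + e * q.[e]], with [q] bounded on the unit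
    interval by the sum of the moduli of its coefficients. *)
Lemma Re_horner0_ge0 (p : {poly C}) :
  (forall e, 0 < e -> 0 <= 'Re p.[e]) -> 0 <= 'Re p.[0].
Proof.
move=> pe; rewrite real_leNgt ?real0 ?Creal_Re //; apply/negP => p0.
have [q pq] : exists q, p - p.[0]%:P = q * ('X - 0%:P).
  by apply/factor_theorem; rewrite /root !hornerE subrr.
have pE e : p.[e] = p.[0] + e * q.[e].
  have := congr1 (fun s => s.[e]) pq; rewrite !hornerE subr0 => /eqP.
  by rewrite subr_eq => /eqP ->; ring.
pose M := \sum_(i < size q) `|q`_i|; pose a := - 'Re p.[0].
have a0 : 0 < a by rewrite oppr_gt0.
have M0 : 0 <= M by apply: sumr_ge0 => i _; exact: normr_ge0.
have aM : 0 < a + M + 1 by rewrite ltr_wpDl // addr_ge0 // ltW.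
(* Small enough that [e <= 1] and [e * M < a]. *)
pose e := a / (a + M + 1); have e0 : 0 < e by rewrite divr_gt0.
have e1 : e <= 1 by rewrite ler_pdivrMr // mul1r -addrA lerDl addr_ge0.
have qM : `|q.[e]| <= M.
  rewrite horner_coef; apply: (le_trans (ler_norm_sum _ _ _)).
  apply: ler_sum => i _; rewrite normrM ler_piMr // normrX.
  by rewrite exprn_ile1 // ger0_norm // ltW.
have := pe e e0; rewrite pE raddfD /= ReMl ?gtr0_real // => /(lt_le_trans _) H.
suff : 'Re p.[0] + e * 'Re q.[e] < 0 by move/H; rewrite ltxx.
rewrite -[X in X + _]opprK -/a addrC subr_lt0.
apply: (@le_lt_trans _ _ (e * M)).
  rewrite ler_pM2l //; apply: le_trans qM.
  by apply: le_trans (real_ler_norm (Creal_Re _)) _; rewrite leif_normC_Re_Creal.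
rewrite /e mulrAC ltr_pdivrMr // ltr_pM2l // -addrA addrCA ltrDl.
by rewrite ltr_pwDr // ltW.
Qed.

Lemma Im_horner0_le0 (p : {poly C}) :
  (forall e, 0 < e -> 'Im p.[e] <= 0) -> 'Im p.[0] <= 0.
Proof.
move=> pe; have ReE x : 'Re (('i *: p).[x]) = - 'Im p.[x].
  by rewrite hornerZ ReMil.
rewrite -oppr_ge0 -ReE; apply: Re_horner0_ge0 => e e0.
by rewrite ReE oppr_ge0 pe.
Qed.

Lemma Im_div_le0 (a b : C) : b != 0 -> ('Im (a / b) <= 0) = ('Im (a * b^*) <= 0).
Proof.
move=> b0; rewrite invC_norm mulrCA [in LHS]ImMl; last first.
  by rewrite rpredV rpredX // normr_real.
by rewrite pmulr_rle0 // invr_gt0 exprn_gt0 // normr_gt0.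
Qed.

Definition real_poly (p : {poly C}) := map_poly Num.conj p = p.

Lemma conj_horner (p : {poly C}) x : real_poly p -> p.[x]^* = p.[x^*].
Proof. by move=> pr; rewrite -horner_map /= pr. Qed.

Lemma real_poly_horner (p : {poly C}) x :
  real_poly p -> x \is Num.real -> p.[x] \is Num.real.
Proof. by move=> pr xr; apply/CrealP; rewrite conj_horner // conj_Creal. Qed.

Lemma real_poly_prod (I : Type) (s : seq I) (Q : pred I) (mu : I -> C) :
  (forall i, mu i \is Num.real) -> real_poly (\prod_(i <- s | Q i) ('X - (mu i)%:P)).
Proof.
move=> mur; rewrite /real_poly map_prod_XsubC.
by apply: eq_bigr => i _ /=; rewrite conj_Creal.
Qed.

(** From [k = 2] on, the [k]-th power takes the upper half-plane to imaginary parts of both signs;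
    this is what excludes multiple poles in [partial_fractions]. *)
Lemma root_upper_half_plane k (c : C) : (1 < k)%N -> c \is Num.real -> c != 0 ->
  exists2 w : C, 0 < 'Im w & w ^+ k = 'i * c.
Proof.
move=> k1 cr c0; exists (k.-root ('i * c)); last by rewrite rootCK // ltnW.
rewrite lt_def Im_rootC_ge0 // andbT; apply/eqP => /Creal_ImP.
move=> /(rpredX k); rewrite rootCK ?(ltnW k1) // => /Creal_ImP.
by rewrite ImMil => rc; move: c0; rewrite -(Creal_ReP _ cr) rc eqxx.
Qed.

Lemma imaginary_neq (x y : C) : 0 < 'Im x -> y \is Num.real -> x - y != 0.
Proof.
move=> xH /Creal_ImP yr; apply: contraTneq xH => /eqP; rewrite subr_eq0 => /eqP->.
by rewrite yr ltxx.
Qed.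

(* Approaching the root [mu l], of multiplicity [k], in the direction [w] gives
   the limit of [n / g], up to a positive factor, as [D / w ^+ k]. *)
Lemma sector_condition r (mu : 'I_r -> C) (n : {poly C}) l (w : C) :
  (forall l, mu l \is Num.real) -> real_poly n ->
  (forall x, 0 < 'Im x -> 'Im (n.[x] / \prod_l (x - mu l)) <= 0) ->
  0 < 'Im w ->
  0 <= n.[mu l] * \prod_(m | mu m != mu l) (mu l - mu m)
       * 'Im (w ^+ #|[pred m | mu m == mu l]|).
Proof.
move=> mur nr nH wH; set k := #|_|.
pose g1 : {poly C} := \prod_(m | mu m != mu l) ('X - (mu m)%:P).
have g1E x : g1.[x] = \prod_(m | mu m != mu l) (x - mu m).
  by rewrite horner_prod; apply: eq_bigr => m _; rewrite !hornerE.
have gE x : \prod_m (x - mu m) = (x - mu l) ^+ k * g1.[x].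
  rewrite g1E (bigID (fun m => mu m == mu l)) /=; congr (_ * _).
  by rewrite (eq_bigr (fun _ => x - mu l)) ?prodr_const // => m /eqP->.
have g1r : real_poly g1 by exact: real_poly_prod.
rewrite -g1E; set D := n.[mu l] * g1.[mu l].
have Dr : D \is Num.real by rewrite rpredM ?real_poly_horner.
pose u : {poly C} := (mu l)%:P + w *: 'X.
have uE t : u.[t] = mu l + w * t by rewrite !hornerE.
pose p := (n \Po u) * ((w ^+ k)^*)%:P * map_poly Num.conj (g1 \Po u).
have pE t : t \is Num.real ->
    p.[t] = n.[mu l + w * t] * (w ^+ k * g1.[mu l + w * t])^*.
  move=> tr; rewrite /p !hornerM hornerC horner_comp uE -mulrA; congr (_ * _).
  rewrite rmorphM; congr (_ * _).
  by rewrite -{1}(conj_Creal tr) horner_map horner_comp uE.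
have : 'Im p.[0] <= 0.
  apply: Im_horner0_le0 => t t0; rewrite pE ?gtr0_real //.
  have xH : 0 < 'Im (mu l + w * t).
    have /Creal_ImP e := mur l.
    by rewrite raddfD /= e add0r ImMr ?gtr0_real // mulr_gt0.
  have := nH _ xH; rewrite Im_div_le0; last first.
    apply/prodf_neq0 => m _; exact: imaginary_neq.
  have -> : \prod_m (mu l + w * t - mu m) = w ^+ k * t ^+ k * g1.[mu l + w * t].
    by rewrite gE -exprMn; congr (_ ^+ _ * _); ring.
  set a := n.[_]; set b := g1.[_].
  have -> : a * (w ^+ k * t ^+ k * b)^* = t ^+ k * (a * (w ^+ k * b)^*).
    rewrite !rmorphM /= [(t ^+ k)^*]conj_Creal ?realX ?gtr0_real //; ring.
  by rewrite ImMl ?realX ?gtr0_real // pmulr_rle0 // exprn_gt0.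
rewrite pE ?real0 // mulr0 addr0 rmorphM /= [(g1.[mu l])^*]conj_Creal; last first.
  exact: real_poly_horner.
have -> : n.[mu l] * ((w ^+ k)^* * g1.[mu l]) = D * (w ^+ k)^* by rewrite /D; ring.
by rewrite ImMl // Im_conj mulrN oppr_le0.
Qed.

(** Common roots cancel, by induction. Without them [sector_condition] forbids multiple poles and
    makes the residues nonnegative, and Lagrange interpolation at the simple poles recovers [n]. *)
Lemma partial_fractions r (mu : 'I_r -> C) (n : {poly C}) :
  (forall l, mu l \is Num.real) -> real_poly n -> (size n <= r)%N ->
  (forall x, 0 < 'Im x -> 'Im (n.[x] / \prod_l (x - mu l)) <= 0) ->
  exists w : 'I_r -> C, (forall l, 0 <= w l) /\
    n = \sum_l w l *: \prod_(m | m != l) ('X - (mu m)%:P).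
Proof.
elim: r mu n => [|r IH] mu n mur nr sn nH.
  exists (fun=> 0); split=> //; rewrite big_ord0; apply/eqP.
  by rewrite -size_poly_leq0.
have [l0 rl0|noroot] := pickP (fun l => root n (mu l)).
  have /factor_theorem[q nq] := rl0.
  have qr : real_poly q.
    have := nr; rewrite /real_poly nq rmorphM /= map_polyXsubC /= conj_Creal //.
    by apply: mulIf; rewrite polyXsubC_eq0.
  have sq : (size q <= r)%N.
    have [->|q0] := eqVneq q 0; first by rewrite size_poly0.
    by move: sn; rewrite nq size_Mmonic ?monicXsubC // size_XsubC addn2.
  have [x xH|w [w0 qw]] := IH (mu \o lift l0) q (fun l => mur _) qr sq.
    have y0 := imaginary_neq xH (mur l0).
    move: (nH x xH); rewrite nq !hornerE (bigD1_ord l0) //=.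
    by rewrite [_ * (x - mu l0)]mulrC -mulf_div divff // mul1r.
  (* The cancelled root gets weight 0. *)
  exists (fun l => if unlift l0 l is Some l' then w l' else 0); split.
    by move=> l; case: unliftP.
  rewrite (bigD1_ord l0) //= unlift_none scale0r add0r nq qw mulr_suml.
  apply: eq_bigr => l _; rewrite liftK -scalerAl; congr (_ *: _).
  rewrite (bigD1_ord l0) ?neq_lift //= mulrC; congr (_ * _).
  by apply: eq_bigl => m; rewrite (inj_eq lift_inj).
have nl l : n.[mu l] != 0 by have := noroot l; rewrite /root => /negbT.
pose p0 l := \prod_(m | m != l) (mu l - mu m).
have D0 l : n.[mu l] * \prod_(m | mu m != mu l) (mu l - mu m) != 0.
  rewrite mulf_neq0 //; apply/prodf_neq0 => m; by rewrite subr_eq0 eq_sym.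
have Dr l : n.[mu l] * \prod_(m | mu m != mu l) (mu l - mu m) \is Num.real.
  rewrite rpredM ?real_poly_horner //; apply: rpred_prod => m _.
  by rewrite rpredB.
(* At a pole of order at least 2, some direction [w] turns the quantity of [sector_condition] into
   minus the square of a nonzero real. *)
have muI : injective mu.
  move=> l l' ell; apply/eqP; apply: contraT => nell.
  have k1 : (1 < #|[pred m | mu m == mu l]|)%N.
    rewrite (cardD1 l) inE eqxx (cardD1 l') !inE ell eqxx andbT eq_sym nell.
    by [].
  have cr : - (n.[mu l] * \prod_(m | mu m != mu l) (mu l - mu m)) \is Num.real.
    by rewrite rpredN.
  have c0 : - (n.[mu l] * \prod_(m | mu m != mu l) (mu l - mu m)) != 0.
    by rewrite oppr_eq0.
  have [w wH wk] := root_upper_half_plane k1 cr c0.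
  have := sector_condition l mur nr nH wH; rewrite wk ImMil.
  have /Creal_ReP -> := cr; rewrite mulrN oppr_ge0 -expr2 lt_geF //.
  by rewrite real_exprn_even_gt0 ?D0.
have p0r l : p0 l \is Num.real by apply: rpred_prod => m _; rewrite rpredB.
have p00 l : p0 l != 0.
  apply/prodf_neq0 => m ml; rewrite subr_eq0 eq_sym.
  by apply: contra ml => /eqP/muI->.
exists (fun l => n.[mu l] / p0 l); split.
  move=> l; have iH : 0 < 'Im ('i : C) by rewrite Im_i.
  have := sector_condition l mur nr nH iH.
  have -> : #|[pred m | mu m == mu l]| = 1%N.
    by rewrite -(card1 l); apply: eq_card => m; rewrite !inE (inj_eq muI).
  under eq_bigl => m do rewrite (inj_eq muI).
  rewrite expr1 Im_i mulr1 => h.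
  have -> : n.[mu l] / p0 l = n.[mu l] * p0 l / p0 l ^+ 2.
    by rewrite expr2 -mulf_div divff // mulr1.
  by rewrite divr_ge0 // real_exprn_even_ge0.
(* Both sides have degree at most [r] and agree at [r + 1] distinct points. *)
apply/eqP; rewrite -subr_eq0; apply/eqP.
apply: (@roots_geq_poly_eq0 _ _ (map mu (enum 'I_r.+1))).
- apply/allP => _ /mapP[l _ ->]; rewrite /root hornerD hornerN horner_sum.
  rewrite (eq_bigr (fun m => if m == l then n.[mu l] else 0)) => [|m _].
    by rewrite -big_mkcond big_pred1_eq subrr.
  rewrite hornerZ horner_prod; under eq_bigr => i _ do rewrite !hornerE.
  case: eqVneq => [->|ml]; first by rewrite divfK //; exact: p00.
  by rewrite (bigD1 l) 1?eq_sym //= subrr mul0r mulr0.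
- by rewrite map_inj_uniq ?enum_uniq.
- rewrite size_map size_enum_ord; apply: (leq_trans (size_polyD _ _)).
  rewrite geq_max sn size_polyN; apply: (leq_trans (size_sum _ _ _)).
  apply/bigmax_leqP => l _; apply: (leq_trans (size_scale_leq _ _)).
  rewrite -big_filter size_prod_XsubC -sum1_size big_filter sum1_card.
  by rewrite cardC1 card_ord.
Qed.

End PartialFractions.

(** * Real specializations *)

Section Boundary.
Variables (C : numClosedFieldType) (N : nat) (T : 'M[C]_N).
Hypothesis hT : hermitian_mx T.

Lemma Im_le_norm (x : C) : 'Im x <= `|x|.
Proof.
rewrite -[x in leRHS]opprK normrN -[leRHS]mul1r -(normCi C) -normrM.
apply: le_trans (leif_normC_Re_Creal _); rewrite ReMil raddfN opprK.
exact: real_ler_norm (Creal_Im _).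
Qed.

(** Moves every variable up by ['i * e]; being polynomial in [e], it lets [Re_horner0_ge0] and
    [Im_horner0_le0] take the limit. *)
Definition pert (z : 'I_N -> C) : 'I_N -> {poly C} := fun i => (z i)%:P + 'i *: 'X.

Lemma pertE z i e : (pert z i).[e] = z i + 'i * e.
Proof. by rewrite !hornerE. Qed.

Lemma Im_pert z i e : 0 < e -> 0 <= 'Im (z i) -> 0 < 'Im (pert z i).[e].
Proof.
move=> e0 zi; rewrite pertE raddfD /= ImMil.
have /Creal_ReP -> := gtr0_real e0.
by rewrite ltr_wpDl.
Qed.

Lemma conj_horner_real (p : {poly C}) e : e \is Num.real ->
  (map_poly Num.conj p).[e] = p.[e]^*.
Proof. by move=> er; rewrite -{1}(conj_Creal er) horner_map. Qed.

(** The inverse of the quotient is [z k] plus the quotient of [mixed_quotient], so its imaginary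
    part is nonnegative. On the closed half-plane the denominator may vanish, hence the product with
    the conjugate in place of the division. *)
Lemma mixed_closed_quotient z P (Y : {set 'I_N}) k :
  well_blocked P (k |: Y) -> k \notin Y -> block_const P z ->
  (forall i, 0 <= 'Im (z i)) ->
  'Im (mixed T z P Y * (mixed T z P (k |: Y))^*) <= 0.
Proof.
move=> wb kY zc z0.
have kP : k \notin flatten P.
  by have /and3P[_ _ /allP PY] := wb; apply/negP => /PY; rewrite setU11.
pose F X := mixed (map_mx polyC T) (pert z) P X.
have FE X e : (F X).[e] = mixed T (fun i => (pert z i).[e]) P X.
  exact: horner_mixed.
have zE X : mixed T z P X = (F X).[0].
  by rewrite FE; apply: eq_mixed => i _; rewrite pertE mulr0 addr0.
suff : 'Im (F Y * map_poly Num.conj (F (k |: Y))).[0] <= 0.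
  by rewrite hornerM conj_horner_real ?real0 // -!zE.
apply: Im_horner0_le0 => e e0.
rewrite hornerM conj_horner_real ?gtr0_real // !FE; set u := (fun i => _).
have uH i : 0 < 'Im (u i) by apply: Im_pert.
have uc : block_const P u.
  by move=> b bP i j ib jb; rewrite /u !pertE (zc b bP i j).
have wbY : well_blocked P Y.
  have /and3P[h1 h2 /allP PY] := wb; rewrite /well_blocked h1 h2 /=.
  by apply/allP => i /PY; rewrite in_setU1 negb_or => /andP[].
have n0 : mixed T u P Y != 0 by apply: mixed_stable.
have := @mixed_quotient _ _ T u P Y k hT wb kY uc (fun i _ => uH i) (fun i _ => uH i).
rewrite [in X in _ -> X](mixed_affine T u kY kP).
set E := mixed T (upd _ _ _) _ _; set n := mixed T u P Y in n0 *.
rewrite -oppr_le0 -raddfN /= -mulNr Im_div_le0 // mulNr raddfN /= oppr_le0 => En.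
rewrite rmorphD rmorphM /= mulrDr raddfD /= mulrCA -normCK ImMr ?rpredX ?normr_real //.
have -> : n * E^* = (E * n^*)^* by rewrite rmorphM /= conjCK mulrC.
rewrite !Im_conj mulNr -opprD oppr_le0 addr_ge0 // mulr_ge0 ?exprn_ge0 //.
exact: ltW.
Qed.

(** Every root [x] lies in the closed lower half-plane, so [t - x] has modulus at least ['Im t].
    Unlike mere nonvanishing, this bound survives a limit. *)
Lemma horner_lower_bound (g : {poly C}) r (t : C) :
  (size g <= r.+1)%N -> g`_r != 0 ->
  (forall x, 0 < 'Im x -> ~~ root g x) -> 0 < 'Im t ->
  `|g`_r| * 'Im t ^+ r <= `|g.[t]|.
Proof.
move=> sg gr gH tH; have [rs grs] := closed_field_poly_normal g.
have sge : size g = r.+1.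
  by apply/eqP; rewrite eqn_leq sg ltnNge; apply: contra gr => /leq_sizeP->.
have lg : lead_coef g = g`_r by rewrite lead_coefE sge.
have srs : size rs = r.
  have := sge; rewrite grs size_scale ?size_prod_XsubC ?lg //; by case.
rewrite [in leRHS]grs hornerZ horner_prod normrM lg ler_pM2l ?normr_gt0 //.
rewrite normr_prod -srs -(count_predT rs) -iter_mulr_1 -big_const_seq.
rewrite !big_seq; apply: ler_prod => x xrs; rewrite (ltW tH) /= !hornerE.
have xH : 'Im x <= 0.
  rewrite real_leNgt ?real0 ?Creal_Im //; apply/negP => xH.
  by have := gH x xH; rewrite grs rootZ ?lg // root_prod_XsubC xrs.
apply: (@le_trans _ _ ('Im (t - x))); first by rewrite raddfB /= lerDl oppr_ge0.
exact: Im_le_norm.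
Qed.

(** A root below the real axis would have its conjugate, also a root, above it. *)
Lemma real_rooted (g : {poly C}) r :
  real_poly g -> (size g <= r.+1)%N -> g`_r != 0 ->
  (forall x, 0 < 'Im x -> ~~ root g x) ->
  exists mu : 'I_r -> C, (forall l, mu l \is Num.real) /\
    g = g`_r *: \prod_l ('X - (mu l)%:P).
Proof.
move=> gr sg g0 gH; have [rs grs] := closed_field_poly_normal g.
have sge : size g = r.+1.
  by apply/eqP; rewrite eqn_leq sg ltnNge; apply: contra g0 => /leq_sizeP->.
have lg : lead_coef g = g`_r by rewrite lead_coefE sge.
have srs : size rs = r.
  have := sge; rewrite grs size_scale ?size_prod_XsubC ?lg //; by case.
exists (fun l => nth 0 rs l); split; last first.
  by rewrite [LHS]grs lg (big_nth 0) big_mkord srs.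
move=> l; set x := nth 0 rs l; have xg : root g x.
  by rewrite grs rootZ ?lg // root_prod_XsubC mem_nth // srs.
apply/Creal_ImP/le_anti; apply/andP; split.
  rewrite real_leNgt ?real0 ?Creal_Im //; apply/negP => /gH; by rewrite xg.
rewrite real_leNgt ?real0 ?Creal_Im //; apply/negP => xH.
have xcH : 0 < 'Im x^* by rewrite Im_conj oppr_gt0.
by have := gH _ xcH; rewrite /root -conj_horner // conjC_eq0 => /negP; apply.
Qed.

Lemma bpoly_real P b z (Y : {set 'I_N}) : (forall i, z i \is Num.real) ->
  real_poly (bpoly T P b z Y).
Proof.
move=> zr; rewrite /real_poly /bpoly rmorph_mixed.
have -> : map_mx (map_poly Num.conj) (map_mx polyC T) = (map_mx polyC T)^T.
  by apply/matrixP => i j; rewrite !mxE map_polyC /= hermitianE.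
rewrite mixed_tr; apply: eq_mixed => i _; rewrite /updX /=.
  by case: ifP => _; rewrite ?map_polyX ?map_polyC //= conj_Creal.
by case: ifP => _; rewrite ?map_polyX ?map_polyC //= conj_Creal.
Qed.

(** Stability applies only after moving the real [z] into the open half-plane, and a limit of
    nonzero values may be zero. The bound of [horner_lower_bound] is kept in the limit, where it is
    positive because [mixed T z P Y] is nonzero. *)
Lemma bpoly_real_rooted P b z (Y : {set 'I_N}) :
  well_blocked (b :: P) Y -> block_const P z ->
  (forall i, z i \is Num.real) -> mixed T z P Y != 0 ->
  exists mu : 'I_(size b) -> C, (forall l, mu l \is Num.real) /\
    bpoly T P b z Y = mixed T z P Y *: \prod_l ('X - (mu l)%:P).
Proof.
move=> wb zc zr n0; have [b0 ub bY wbP] := well_blocked_cons wb.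
rewrite -(coef_bpoly T z ub bY); apply: real_rooted; first exact: bpoly_real.
- exact: size_bpoly.
- by rewrite coef_bpoly.
move=> t tH; rewrite /root horner_bpoly.
pose B := [set i in b] :|: Y.
pose u (i : 'I_N) : {poly C} := if i \in b then t%:P else pert z i.
pose F := mixed (map_mx polyC T) u P B.
pose G := mixed (map_mx polyC T) (pert z) P Y.
have FE e : F.[e] = (bpoly T P b (fun i => (pert z i).[e]) Y).[t].
  rewrite horner_bpoly horner_mixed; apply: eq_mixed => i _;
    by rewrite /u /upds; case: ifP; rewrite ?hornerC.
have GE e : G.[e] = (bpoly T P b (fun i => (pert z i).[e]) Y)`_(size b).
  by rewrite coef_bpoly // horner_mixed.
have F0 : mixed T (upds z b t) P B = F.[0].
  by rewrite horner_mixed; apply: eq_mixed => i _;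
    rewrite /u /upds; case: ifP; rewrite ?hornerC ?pertE ?mulr0 ?addr0.
have G0 : mixed T z P Y = G.[0].
  by rewrite horner_mixed; apply: eq_mixed => i _; rewrite ?pertE ?mulr0 ?addr0.
rewrite F0; rewrite G0 in n0.
pose m := 'Im t ^+ size b.
(* At real [e] this is the difference of two squared moduli, so the bound becomes the sign of a
   polynomial in [e]. *)
pose p := F * map_poly Num.conj F - (m ^+ 2) *: (G * map_poly Num.conj G).
have pE e : e \is Num.real -> p.[e] = `|F.[e]| ^+ 2 - (m * `|G.[e]|) ^+ 2.
  move=> er; rewrite /p hornerD hornerN hornerZ !hornerM.
  by rewrite !conj_horner_real // -!normCK exprMn.
have m0 : 0 < m by rewrite exprn_gt0.
have pr e : e \is Num.real -> p.[e] \is Num.real.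
  by move=> er; rewrite pE // rpredB ?rpredX ?rpredM ?normr_real // gtr0_real.
have : 0 <= 'Re p.[0].
  apply: Re_horner0_ge0 => e e0; have er := gtr0_real e0.
  have /Creal_ReP -> := pr e er.
  rewrite pE // subr_ge0 ler_pXn2r ?nnegrE ?mulr_ge0 ?normr_ge0 ?(ltW m0) //.
  set zz := fun i => (pert z i).[e].
  have zH i : 0 < 'Im (zz i).
    by apply: Im_pert => //; have /Creal_ImP -> := zr i.
  have zzc : block_const P zz.
    by move=> c cP i j ic jc; rewrite /zz !pertE (zc c cP i j).
  have wbY : well_blocked P Y.
    by have := wbP finset.set0 (finset.sub0set _); rewrite finset.set0U.
  rewrite FE GE -/zz mulrC; apply: horner_lower_bound => //.
  - exact: size_bpoly.
  - by rewrite coef_bpoly //; apply: mixed_stable.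
  move=> x xH; rewrite /root horner_bpoly; apply: mixed_stable => //.
  - exact: wbP.
  - move=> c cP i j ic jc; rewrite /upds.
    have ncb k : k \in c -> (k \in b) = false.
      move=> kc; apply/negP => /(allP bY)/andP[_ /negP]; apply.
      by apply/flattenP; exists c.
    by rewrite !ncb // (zzc c cP i j).
  - by move=> i _; rewrite /upds; case: ifP.
  - by move=> i _; rewrite /upds; case: ifP.
have /Creal_ReP -> := pr 0 (real0 _); rewrite pE ?real0 // subr_ge0.
rewrite ler_pXn2r ?nnegrE ?mulr_ge0 ?normr_ge0 ?(ltW m0) // => h.
by rewrite -normr_gt0; apply: lt_le_trans h; rewrite mulr_gt0 ?normr_gt0.
Qed.

End Boundary.

(** * The barrier *)

Section Barrier.
Variables (C : numClosedFieldType).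

Definition shift (r : nat) (s : C) : C := s * (r.-1%:R / r%:R) ^+ 2.

Lemma real_ge_double (a y : C) : a \is Num.real -> 0 < y ->
  a *+ 2 - a ^+ 2 / y <= y.
Proof.
move=> ar y0; rewrite -subr_ge0.
have -> : y - (a *+ 2 - a ^+ 2 / y) = (y - a) ^+ 2 / y by field; rewrite gt_eqF.
rewrite divr_ge0 ?(ltW y0) // real_exprn_even_ge0 //.
by rewrite rpredB // gtr0_real.
Qed.

(** A bound on the sum of the inverses bounds the [r - 1] other distances from below, through
    [real_ge_double] with one common [a]. *)
Lemma barrier_gap r (y : 'I_r -> C) s l0 :
  (forall l, 0 < y l) -> 0 < s -> \sum_l (y l)^-1 <= r%:R / s ->
  y l0 + r%:R * shift r s <= \sum_l y l.
Proof.
move=> y0 s0 ys; have r0 : (0 < r)%N by case: (r) l0 => [[]|].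
have rn0 : r%:R != 0 :> C by rewrite pnatr_eq0 -lt0n.
have rE : r.-1%:R = r%:R - 1 :> C by rewrite -subn1 natrB.
(* This [a] maximizes [2 * a * (r - 1) - a ^+ 2 * r / s], and the maximum [r * shift r s] is the
   origin of [shift]. *)
rewrite (bigD1 l0) //= lerD2l; pose a := r.-1%:R * s / r%:R.
have a0 : 0 <= a by rewrite !mulr_ge0 ?invr_ge0 ?ler0n // ltW.
apply: (@le_trans _ _ (\sum_(l | l != l0) (a *+ 2 - a ^+ 2 / y l))); last first.
  by apply: ler_sum => l _; apply: real_ge_double => //; exact: ger0_real.
rewrite sumrB sumr_const cardC1 card_ord -mulr_sumr.
have h : \sum_(l | l != l0) (y l)^-1 <= r%:R / s.
  by apply: le_trans ys; rewrite [leRHS](bigD1 l0) //= lerDr invr_ge0 ltW.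
apply: (@le_trans _ _ (a *+ 2 *+ r.-1 - a ^+ 2 * (r%:R / s))); last first.
  by rewrite lerD2l lerN2 ler_wpM2l // exprn_ge0.
suff -> : a *+ 2 *+ r.-1 - a ^+ 2 * (r%:R / s) = r%:R * shift r s by [].
rewrite -[_ *+ r.-1]mulr_natr /a /shift; field.
by rewrite rn0 gt_eqF.
Qed.

Lemma deriv_prod_XsubC r (mu : 'I_r -> C) :
  (\prod_l ('X - (mu l)%:P))^`() = \sum_l \prod_(m | m != l) ('X - (mu m)%:P).
Proof.
elim: r mu => [|r IH] mu; first by rewrite !big_ord0 derivC.
rewrite !big_ord_recl derivM derivXsubC mul1r; congr (_ + _).
  by rewrite [RHS]big_mkcond big_ord_recl /= mul1r.
rewrite IH mulr_sumr; apply: eq_bigr => l _.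
rewrite [RHS](bigD1_ord ord0) //=.
Qed.

Lemma coef_prod_XsubC_neq r (mu : 'I_r -> C) l :
  (\prod_(m | m != l) ('X - (mu m)%:P))`_r.-1 = 1.
Proof.
have e : size (\prod_(m | m != l) ('X - (mu m)%:P)) = r.-1.+1.
  rewrite -big_filter size_prod_XsubC -sum1_size big_filter sum1_card.
  by rewrite cardC1 card_ord.
have := monicP (monic_prod_XsubC (index_enum 'I_r) (fun m => m != l) mu).
by rewrite lead_coefE e.
Qed.

Lemma coef_prod_XsubC_neq_top r (mu : 'I_r -> C) l :
  (\prod_(m | m != l) ('X - (mu m)%:P))`_r = 0.
Proof.
rewrite nth_default // -big_filter size_prod_XsubC -sum1_size big_filter.
by rewrite sum1_card cardC1 card_ord prednK //; case: (r) l => [[]|].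
Qed.

Lemma coef_prod_XsubC_pred r (mu : 'I_r -> C) : (0 < r)%N ->
  (\prod_l ('X - (mu l)%:P))`_r.-1 = - \sum_l mu l.
Proof.
move=> r0; pose rs := [seq mu l | l <- index_enum 'I_r].
have srs : size rs = r by rewrite size_map -sum1_size sum1_card card_ord.
have := @coefPn_prod_XsubC _ rs; rewrite srs -lt0n => /(_ r0).
by rewrite !big_map.
Qed.

Lemma coef_prod_XsubC_top r (mu : 'I_r -> C) :
  (\prod_l ('X - (mu l)%:P))`_r = 1.
Proof.
have := monicP (monic_prod_XsubC (index_enum 'I_r) predT mu).
by rewrite lead_coefE size_prod_XsubC -sum1_size sum1_card card_ord.
Qed.

(* [average r t p] is, up to the factor [(r - 1)!], the value at [t] of the
   derivative of order [r - 1] of a polynomial [p] of degree at most [r], and a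
   multiple of the difference of [t] and the mean of the roots of [p]. *)
Definition average r (t : C) (p : {poly C}) := t * p`_r *+ r + p`_r.-1.

Section UnivariateBarrier.
Variables (r : nat) (mu : 'I_r -> C) (c w s : C).
Hypotheses (r0 : (0 < r)%N) (mur : forall l, mu l \is Num.real) (c0 : 0 < c).
Hypotheses (s0 : 0 < s) (wr : w \is Num.real) (muw : forall l, mu l < w).
Let g := c *: \prod_l ('X - (mu l)%:P).
Hypothesis gw : g^`().[w] <= r%:R / s * g.[w].
(** This is [r] times the distance from the mean of the roots to the moved point. *)
Let q := \sum_l (w - mu l) - r%:R * shift r s.

Let y0 l : 0 < w - mu l. Proof. by rewrite subr_gt0. Qed.

Let prod_neq l : \prod_(m | m != l) (w - mu m) = (\prod_m (w - mu m)) / (w - mu l).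
Proof. by rewrite [in RHS](bigD1 l) //= mulrAC divff ?mul1r // gt_eqF. Qed.

Let horner_neq l : (\prod_(m | m != l) ('X - (mu m)%:P)).[w] =
  (\prod_m (w - mu m)) / (w - mu l).
Proof.
by rewrite horner_prod -prod_neq; apply: eq_bigr => m _; rewrite !hornerE.
Qed.

Let horner_g : g.[w] = c * \prod_m (w - mu m).
Proof.
by rewrite hornerZ horner_prod; congr (_ * _); apply: eq_bigr => m _; rewrite !hornerE.
Qed.

Let p0 : 0 < \prod_m (w - mu m). Proof. by apply: prodr_gt0. Qed.

Let gap l : w - mu l <= q.
Proof.
rewrite lerBrDr; apply: barrier_gap => //.
move: gw; rewrite horner_g derivZ hornerZ deriv_prod_XsubC horner_sum.
rewrite (eq_bigr _ (fun m _ => horner_neq m)) -mulr_sumr mulrA.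
by rewrite [X in _ <= X]mulrC ler_pM2l // mulr_gt0.
Qed.

Let q0 : 0 < q.
Proof. by apply: lt_le_trans (gap (Ordinal r0)). Qed.

Let average_g : average r (w - shift r s) g = c * q.
Proof.
rewrite /average !coefZ coef_prod_XsubC_top coef_prod_XsubC_pred // /q sumrB.
rewrite sumr_const card_ord -mulr_natr -[w *+ r]mulr_natr; ring.
Qed.

Lemma average_gt0 : 0 < average r (w - shift r s) g.
Proof. by rewrite average_g mulr_gt0. Qed.

(** Write [n / g] as a constant plus simple fractions with weights [u l / c]. Passing from the value
    at [w] to the average replaces each [u l / (w - mu l)] by [u l / q], which is not larger by
    [gap]. *)
Lemma average_le n : real_poly n -> (size n <= r.+1)%N ->
  (forall x, 0 < 'Im x -> 'Im (n.[x] / g.[x]) <= 0) -> s * n.[w] <= g.[w] ->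
  s * average r (w - shift r s) n <= average r (w - shift r s) g.
Proof.
move=> nr sn nH nw.
have gtop : g`_r = c by rewrite coefZ coef_prod_XsubC_top mulr1.
pose k := n`_r / c.
have nrr : n`_r \is Num.real.
  by apply/CrealP; rewrite -coef_map /= nr.
have kr : k \is Num.real by rewrite rpredM // rpredV gtr0_real.
have gr : real_poly g.
  by rewrite /real_poly map_polyZ /= real_poly_prod // conj_Creal // gtr0_real.
have [||x xH|u [u0 nu]] := @partial_fractions C r mu (n - k *: g) mur.
- by rewrite /real_poly rmorphB /= map_polyZ /= gr nr conj_Creal.
- apply/leq_sizeP => j; rewrite leq_eqVlt => /predU1P[<-|rj].
    by rewrite coefB coefZ gtop divfK ?subrr // gt_eqF.
  rewrite coefB coefZ; rewrite [n`_j]nth_default ?(leq_trans sn) //.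
  rewrite [g`_j]nth_default ?mulr0 ?subr0 // size_scale ?gt_eqF //.
  by rewrite size_prod_XsubC -sum1_size sum1_card card_ord.
- have gx : g.[x] = c * \prod_l (x - mu l).
    rewrite hornerZ horner_prod; congr (_ * _).
    by apply: eq_bigr => m _; rewrite !hornerE.
  have px : \prod_l (x - mu l) != 0.
    by apply/prodf_neq0 => l _; exact: imaginary_neq.
  rewrite hornerD hornerN hornerZ.
  have -> : (n.[x] - k * g.[x]) / \prod_l (x - mu l) = c * (n.[x] / g.[x]) - k * c.
    by rewrite gx; field; rewrite px gt_eqF.
  rewrite raddfB /= ImMl ?gtr0_real //.
  have /Creal_ImP -> : k * c \is Num.real by rewrite rpredM // gtr0_real.
  by rewrite subr0 pmulr_rle0 // nH.
have nE : n = k *: g + \sum_l u l *: \prod_(m | m != l) ('X - (mu m)%:P).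
  by rewrite -nu addrC subrK.
have -> : average r (w - shift r s) n = k * (c * q) + \sum_l u l.
  rewrite -average_g nE /average !coefD !coefZ !coef_sum.
  have -> : \sum_l (u l *: \prod_(m | m != l) ('X - (mu m)%:P))`_r = 0.
    by apply: big1 => l _; rewrite coefZ coef_prod_XsubC_neq_top mulr0.
  have -> : \sum_l (u l *: \prod_(m | m != l) ('X - (mu m)%:P))`_r.-1 = \sum_l u l.
    by apply: eq_bigr => l _; rewrite coefZ coef_prod_XsubC_neq mulr1.
  by rewrite addr0 addrA -[_ *+ r]mulr_natr -[X in _ = k * (X + _) + _]mulr_natr; ring.
rewrite average_g.
have hw : s * (k * c + \sum_l u l / (w - mu l)) <= c.
  rewrite -(ler_pM2r p0) -horner_g; apply: le_trans nw.
  rewrite -mulrA ler_pM2l // le_eqVlt; apply/orP; left; apply/eqP.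
  rewrite nE hornerD hornerZ horner_g horner_sum mulrDl mulrA; congr (_ + _).
  rewrite mulr_suml; apply: eq_bigr => l _.
  by rewrite hornerZ horner_neq mulrAC mulrA.
rewrite mulrC in hw.
apply: (@le_trans _ _ (q * (s * (k * c + \sum_l u l / (w - mu l))))); last first.
  by rewrite mulrC ler_pM2r // mulrC.
rewrite [leRHS]mulrCA ler_pM2l // [leRHS]mulrDr.
have -> : q * (k * c) = k * (c * q) by ring.
rewrite lerD2l mulr_sumr; apply: ler_sum => l _.
by rewrite mulrCA ler_peMr // ler_pdivlMr // mul1r.
Qed.
End UnivariateBarrier.

End Barrier.

(** * Induction of the barrier over the blocks *)

Section Selection.
Variables (C : numClosedFieldType) (N : nat).
Implicit Types (T : 'M[C]_N) (z v : 'I_N -> C) (Y S : {set 'I_N}).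

Definition sqnorm v : C := \sum_i `|v i| ^+ 2.

Lemma sqnorm_gt0 v : (exists i, v i != 0) -> 0 < sqnorm v.
Proof.
move=> [i vi]; rewrite /sqnorm (bigD1 i) //= ltr_pwDl ?exprn_gt0 ?normr_gt0 //.
by apply: sumr_ge0 => j _; rewrite exprn_ge0.
Qed.

Lemma qform_diag T z v :
  qform (\matrix_(i, j) (T i j - z i *+ (i == j))) v =
  qform T v - \sum_i z i * `|v i| ^+ 2.
Proof.
rewrite /qform -sumrB; apply: eq_bigr => i _.
transitivity (\sum_j ((v i)^* * T i j * v j - (v i)^* * (z i *+ (i == j)) * v j)).
  by apply: eq_bigr => j _; rewrite mxE; ring.
rewrite sumrB; congr (_ - _); rewrite (bigD1 i) //= big1 => [|j ji].
  by rewrite eqxx mulr1n addr0 normCK; ring.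
by rewrite eq_sym (negPf ji) mulr0n mulr0 mul0r.
Qed.

(** The minor is the value at 0 of the characteristic polynomial on [Y], and by [minor_kernel] each
    root times a positive square norm is a value of the form, hence negative. *)
Lemma minor_gt0_const T Y : hermitian_mx T ->
  (forall v, (exists i, v i != 0) -> (forall i, i \notin Y -> v i = 0) ->
     qform T v < 0) ->
  0 < minor T (fun=> 0) Y.
Proof.
move=> hT neg; pose p := bpoly T [::] (enum Y) (fun=> 0) finset.set0.
have eY : all (fun k => (k \notin finset.set0) && (k \notin flatten [::])) (enum Y).
  by apply/allP => i _; rewrite inE.
have pE t : p.[t] = minor T (fun=> t) Y.
  rewrite horner_bpoly; have -> : [set i in enum Y] :|: finset.set0 = Y.
    by apply/setP => i; rewrite !inE mem_enum orbF.
  by apply: eq_minor => i iY; rewrite /upds mem_enum iY.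
have sp : (size p <= (size (enum Y)).+1)%N by apply: size_bpoly; rewrite ?enum_uniq.
have ptop : p`_(size (enum Y)) = 1.
  rewrite coef_bpoly ?enum_uniq //= /minor -(det1 C N); congr (\det _).
  by apply/matrixP => i j; rewrite !mxE inE.
have [rs prs] := closed_field_poly_normal p.
have lp : lead_coef p = 1.
  rewrite lead_coefE; suff -> : size p = (size (enum Y)).+1 by [].
  apply/eqP; rewrite eqn_leq sp ltnNge; apply/negP => /leq_sizeP/(_ _ (leqnn _)).
  by rewrite ptop => /eqP; rewrite oner_eq0.
rewrite -pE prs lp scale1r horner_prod big_seq; apply: prodr_gt0 => x xrs.
rewrite hornerXsubC sub0r oppr_gt0.
have : root p x by rewrite prs lp scale1r root_prod_XsubC.
rewrite /root pE => /eqP/minor_kernel[u [u0 uY e]].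
have := neg u u0 uY; rewrite -e -mulr_sumr => h.
by have := h; rewrite pmulr_llt0 // sqnorm_gt0.
Qed.

Lemma minor_gt0 T z Y : hermitian_mx T -> (forall i, z i \is Num.real) ->
  (forall v, (exists i, v i != 0) -> (forall i, i \notin Y -> v i = 0) ->
     qform T v < \sum_i z i * `|v i| ^+ 2) ->
  0 < minor T z Y.
Proof.
move=> hT zr pos; pose U := \matrix_(i, j) (T i j - z i *+ (i == j)).
have -> : minor T z Y = minor U (fun=> 0) Y.
  congr (\det _); apply/matrixP => i j; rewrite !mxE.
  by case: ifP => // _; rewrite mul0rn sub0r opprB.
apply: minor_gt0_const => [|v v0 vY].
  apply/matrixP => i j; rewrite !mxE rmorphB rmorphMn /= hermitianE // eq_sym.
  by congr (_ - _); case: eqP => [->|//]; rewrite conj_Creal.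
by rewrite qform_diag subr_lt0; exact: pos.
Qed.

Section BarrierInduction.
Variables (T : 'M[C]_N) (w s : C) (r : nat).
Hypotheses (hT : hermitian_mx T) (wr : w \is Num.real) (s0 : 0 < s).
Hypothesis gapT : forall j v, (exists i, v i != 0) ->
  s * `|v j| ^+ 2 + qform T v < w * sqnorm v.

(** The second clause bounds the logarithmic derivative in each [z j] by [1 / s]. The variables of
    [Y] may lie anywhere to the right of [w]: [barrier_cons] uses this to exclude roots beyond
    [w]. *)
Definition barrier P := forall Y z, well_blocked P Y ->
  (forall i, z i \is Num.real) -> {in Y, forall i, w <= z i} ->
  {in flatten P, forall i, z i = w - shift r s} ->
  0 < mixed T z P Y /\
  {in Y, forall j, s * mixed T z P (Y :\ j) <= mixed T z P Y}.

Lemma barrier_nil : barrier [::].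
Proof.
move=> Y z _ zr zY _ /=.
(* [gapT] leaves room to lower one variable, that of [j], by [s] below [w]. *)
have key u : (forall i, u i \is Num.real) ->
    (exists j, forall v i, i \in Y ->
       w * `|v i| ^+ 2 - s * (`|v i| ^+ 2 *+ (i == j)) <= u i * `|v i| ^+ 2) ->
    0 < minor T u Y.
  move=> ur [j uY]; apply: minor_gt0 => // v v0 vY.
  have := gapT j v0; rewrite addrC -ltrBrDr => /lt_le_trans; apply.
  have -> : s * `|v j| ^+ 2 = \sum_i s * (`|v i| ^+ 2 *+ (i == j)).
    rewrite (bigD1 j) //= eqxx mulr1n big1 ?addr0 // => i /negPf->.
    by rewrite mulr0n mulr0.
  rewrite /sqnorm mulr_sumr -sumrB; apply: ler_sum => i _.
  have [iY|iY] := boolP (i \in Y); first exact: uY.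
  by rewrite vY // normr0 expr0n mul0rn !mulr0 subr0.
have sq (v : 'I_N -> C) i : 0 <= `|v i| ^+ 2 by rewrite exprn_ge0.
split.
  have [j jY|Y0] := pickP (mem Y).
    apply: key => //; exists j => v i iY; rewrite lerBlDr.
    apply: ler_wpDr; last by rewrite ler_wpM2r ?zY.
    by rewrite mulr_ge0 ?(ltW s0) // mulrn_wge0.
  rewrite /minor; suff -> : minor_mx T z Y = 1%:M by rewrite det1.
  by apply/matrixP => i j; rewrite !mxE; have := Y0 i; rewrite inE => ->.
move=> j jY; have jN : j \notin Y :\ j by rewrite !inE eqxx.
have YE : Y = j |: Y :\ j by rewrite finset.setD1K.
(* Lowering [z j] by [s] subtracts [s] times the minor on [Y :\ j], so the claim follows from
   positivity at the lowered point. *)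
have : 0 < minor T (upd z j (z j - s)) Y.
  apply: key => [i|].
    by rewrite /upd; case: ifP => // _; rewrite rpredB // gtr0_real.
  exists j => v i iY; rewrite /upd; case: eqP => [->|_].
    by rewrite mulr1n mulrBl lerD2r ler_wpM2r ?zY.
  by rewrite mulr0n mulr0 subr0 ler_wpM2r ?zY.
have e1 := minor_affine T z jN.
have := minor_affine T (upd z j (z j - s)) jN; rewrite -YE in e1 *.
rewrite e1 {2}/upd eqxx => ->.
have -> : minor T (upd z j (z j - s)) (Y :\ j) = minor T z (Y :\ j).
  by apply: eq_minor => i iY; rewrite /upd; case: eqP iY jN => // -> ->.
have -> : minor T (upd (upd z j (z j - s)) j 0) Y = minor T (upd z j 0) Y.
  by apply: eq_minor => i iY; rewrite /upd; case: eqP.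
by move=> /ltW; rewrite mulrBl addrAC subr_ge0.
Qed.

(** Moving the block into [Y] with a common variable reduces to one variable: the induction
    hypothesis right of [w] puts the roots of [bpoly] below [w], and at [w] it gives the two
    inequalities that [average_le] needs, one for the derivative and one for each [j]. *)
Lemma barrier_cons b P : size b = r -> barrier P -> barrier (b :: P).
Proof.
move=> br IH Y z wb zr zY zP; have [b0 ub bY wbP] := well_blocked_cons wb.
have wbY : well_blocked P Y.
  by have := wbP finset.set0 (finset.sub0set _); rewrite finset.set0U.
have zPP : {in flatten P, forall i, z i = w - shift r s}.
  by move=> i iP; apply: zP; rewrite /= mem_cat iP orbT.
have zb : {in b, forall i, z i = w - shift r s}.
  by move=> i ib; apply: zP; rewrite /= mem_cat ib.
have zc : block_const P z.
  by move=> c cP i j ic jc; rewrite !zPP //; apply/flattenP; exists c.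
have bP i : i \in flatten P -> (i \in b) = false.
  by move=> iP; apply/negP => /(allP bY); rewrite iP andbF.
have bNY i : i \in Y -> (i \in b) = false.
  by move=> iY; apply/negP => /(allP bY); rewrite iY.
have [c0 _] := IH Y z wbY zr zY zPP.
have upds_ok x (B : {set 'I_N}) : B \subset [set i in b] -> x \is Num.real -> w <= x ->
    0 < mixed T (upds z b x) P (B :|: Y) /\
    {in B :|: Y, forall j, s * mixed T (upds z b x) P ((B :|: Y) :\ j)
                     <= mixed T (upds z b x) P (B :|: Y)}.
  move=> sB xr wx; apply: IH; first exact: wbP.
  - by move=> i; rewrite /upds; case: ifP.
  - move=> i; rewrite finset.in_setU /upds => /orP[iB|iY].
      by have := fintype.subsetP sB i iB; rewrite inE => ->.
    by case: ifP => // _; exact: zY.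
  - by move=> i iP; rewrite /upds bP // zPP.
have [mu [mur gmu]] := bpoly_real_rooted hT wb zc zr (lt0r_neq0 c0).
move: mu mur gmu; rewrite br => mu mur gmu.
have muw l : mu l < w.
  rewrite real_ltNge //; apply/negP => wmu.
  have [gpos _] := upds_ok (mu l) _ (fintype.subxx _) (mur l) wmu.
  have := horner_bpoly T P b z Y (mu l); rewrite gmu hornerZ horner_prod.
  rewrite (bigD1 l) //= hornerXsubC subrr mul0r mulr0 => e.
  by move: gpos; rewrite -e ltxx.
have [gw0 gws] := upds_ok w _ (fintype.subxx _) wr (lexx _).
have gw : (bpoly T P b z Y)^`().[w] <= r%:R / s * (bpoly T P b z Y).[w].
  rewrite deriv_bpoly // horner_sum horner_bpoly -br -(count_predT b).
  rewrite -sum1_count natr_sum !mulr_suml !big_seq; apply: ler_sum => k kb.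
  rewrite horner_mixed mul1r mulrC ler_pdivlMr // mulrC.
  have := gws k; rewrite finset.in_setU inE kb => /(_ isT).
  congr (_ <= _); congr (_ * _).
  have -> : ([set i in b] :|: Y) :\ k = [set i in b] :\ k :|: Y.
    apply/setP => i; rewrite !inE; case: (i =P k) => [->|//] /=.
    by rewrite (negPf (proj1 (andP (allP bY k kb)))).
  by apply: eq_mixed => i _; rewrite /upds /updX; case: ifP; rewrite ?hornerX ?hornerC.
have avgE X : well_blocked (b :: P) X -> mixed T z (b :: P) X =
    average r (w - shift r s) (bpoly T P b z X).
  move=> wX; have [_ _ bX _] := well_blocked_cons wX.
  by rewrite (mixed_cons _ (t := w - shift r s)) // br.
have r0 : (0 < r)%N by rewrite -br.
rewrite gmu in gw.
split; first by rewrite avgE // gmu; exact: average_gt0.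
move=> j jY; have wbj : well_blocked (b :: P) (Y :\ j).
  have /and3P[h1 h2 /allP h3] := wb; rewrite /well_blocked h1 h2 /=.
  by apply/allP => i /h3; rewrite !inE => /negPf->; rewrite andbF.
have [_ _ bYj _] := well_blocked_cons wbj.
rewrite !avgE // [X in _ <= average _ _ X]gmu; apply: average_le => //.
- exact: bpoly_real.
- by rewrite -br; exact: size_bpoly.
- move=> x xH; rewrite -gmu !horner_bpoly.
  have jb := bNY j jY.
  have uni : [set i in b] :|: Y = j |: ([set i in b] :|: Y :\ j).
    apply/setP => i; rewrite !inE; case: (i =P j) => [->|//]; by rewrite jY orbT.
  have uc : block_const P (upds z b x).
    by move=> c cP i k ic kc; rewrite /upds !bP ?(zc c cP i k) //; apply/flattenP; exists c.
  rewrite uni Im_div_le0.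
    apply: mixed_closed_quotient => //.
    + by rewrite -uni; apply: wbP.
    + by rewrite !inE jb eqxx.
    + move=> i; rewrite /upds; case: ifP => _; first exact: ltW.
      by have /Creal_ImP -> := zr i.
  rewrite -uni -horner_bpoly gmu hornerZ horner_prod mulf_neq0 ?(lt0r_neq0 c0) //.
  by apply/prodf_neq0 => l _; rewrite !hornerE; exact: imaginary_neq.
- rewrite -gmu !horner_bpoly; have := gws j.
  rewrite finset.in_setU jY orbT => /(_ isT); congr (_ * mixed _ _ _ _ <= _).
  apply/setP => i; rewrite !inE; case: (i =P j) => [->|//] /=.
  by rewrite (bNY j jY).
Qed.

Lemma barrier_all P : all (fun b => size b == r) P -> barrier P.
Proof.
elim: P => [|b P IH] /=; first by move=> _; exact: barrier_nil.
by move=> /andP[/eqP br /IH]; exact: barrier_cons.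
Qed.

End BarrierInduction.

End Selection.

(** * Interlacing descent *)

Section Descent.
Variables (C : numClosedFieldType) (N : nat) (T : 'M[C]_N).
Hypothesis hT : hermitian_mx T.
Implicit Types (P : seq (seq 'I_N)) (Y S : {set 'I_N}).

Let TX := map_mx polyC T.

(** Every choice of one index per block contributes a monic polynomial of this degree. *)
Lemma size_coef_mixedX P Y : well_blocked P Y ->
  (size (mixed TX (fun=> 'X) P Y) <= (#|Y| + size P).+1)%N /\
  0 < (mixed TX (fun=> 'X) P Y)`_(#|Y| + size P).
Proof.
elim: P Y => [|b P IH] Y wb.
  have eY : all (fun k => (k \notin finset.set0) && (k \notin flatten [::])) (enum Y).
    by apply/allP => i _; rewrite inE.
  have -> : mixed TX (fun=> 'X) [::] Y = bpoly T [::] (enum Y) (fun=> 0) finset.set0.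
    rewrite /bpoly; have -> : [set i in enum Y] :|: finset.set0 = Y.
      by apply/setP => i; rewrite !inE mem_enum orbF.
    by apply: eq_minor => i iY; rewrite /updX mem_enum iY.
  rewrite addn0 cardE; split; first by apply: size_bpoly; rewrite ?enum_uniq.
  rewrite coef_bpoly ?enum_uniq //= /minor.
  suff -> : minor_mx T (fun=> 0) finset.set0 = 1%:M by rewrite det1.
  by apply/matrixP => i j; rewrite !mxE inE.
have [b0 ub bY wbP] := well_blocked_cons wb.
have wbk k : k \in b -> well_blocked P (k |: Y).
  by move=> kb; apply: wbP; rewrite finset.sub1set inE.
have card k : k \in b -> (#|k |: Y| + size P = #|Y| + size (b :: P))%N.
  by move=> /(allP bY)/andP[kY _]; rewrite cardsU1 kY /= addnS.
split=> /=.
  apply: (leq_trans (size_sum _ _ _)); apply/bigmax_leqP_seq => k kb _.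
  by have [] := IH _ (wbk k kb); rewrite card.
rewrite coef_sum; case: b b0 {ub bY wb wbP} wbk card => // k b _ wbk card.
rewrite big_cons ltr_pwDl //.
  have kb : k \in k :: b by rewrite mem_head.
  by have [_] := IH _ (wbk k kb); rewrite card.
rewrite big_seq; apply: sumr_ge0 => l lb.
have lkb : l \in k :: b by rewrite inE lb orbT.
by have [_] := IH _ (wbk l lkb); rewrite card // => /ltW.
Qed.

Lemma size_mixedX_upd P Y k : well_blocked P (k |: Y) -> k \notin Y ->
  (size (mixed TX (upd (fun=> 'X) k 0) P (k |: Y)) <= (#|Y| + size P).+1)%N.
Proof.
elim: P Y => [|b P IH] Y wb kY.
  have eY : all (fun i => (i \notin [set k]) && (i \notin flatten [::])) (enum Y).
    by apply/allP => i; rewrite mem_enum inE andbT; apply: contraTneq => ->.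
  have -> : mixed TX (upd (fun=> 'X) k 0) [::] (k |: Y) =
            bpoly T [::] (enum Y) (fun=> 0) [set k].
    rewrite /bpoly; have -> : [set i in enum Y] :|: [set k] = k |: Y.
      by apply/setP => i; rewrite !inE mem_enum orbC.
    apply: eq_minor => i; rewrite in_setU1 /updX /upd mem_enum.
    by case: eqP => [->|_ /= ->] //; rewrite (negPf kY).
  by rewrite addn0 cardE; apply: size_bpoly; rewrite ?enum_uniq.
have [b0 ub bY wbP] := well_blocked_cons wb.
rewrite /=; apply: (leq_trans (size_sum _ _ _)).
apply/bigmax_leqP_seq => l lb _; have /andP[lY lP] := allP bY l lb.
rewrite in_setU1 negb_or in lY; have /andP[lk lY'] := lY.
rewrite finset.setUCA; apply: leq_trans (IH (l |: Y) _ _) _.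
- by rewrite finset.setUCA; apply: wbP; rewrite finset.sub1set inE.
- by rewrite in_setU1 negb_or kY eq_sym lk.
- by rewrite cardsU1 lY' addnS.
Qed.

Lemma real_poly_mixed (u : 'I_N -> {poly C}) P Y :
  (forall i, real_poly (u i)) -> real_poly (mixed TX u P Y).
Proof.
move=> ur; rewrite /real_poly rmorph_mixed.
have -> : map_mx (map_poly Num.conj) TX = TX^T.
  by apply/matrixP => i j; rewrite !mxE map_polyC /= hermitianE.
by rewrite mixed_tr; apply: eq_mixed => i _; exact: ur.
Qed.

Lemma real_polyX : real_poly ('X : {poly C}).
Proof. by rewrite /real_poly map_polyX. Qed.

Lemma horner_mixedX P Y x : (mixed TX (fun=> 'X) P Y).[x] = mixed T (fun=> x) P Y.
Proof. by rewrite horner_mixed; apply: eq_mixed => i _; rewrite hornerX. Qed.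

(* With [h] the polynomial of [(P, Y)] and [g_k] that of [(P, k |: Y)], the
   quotient [g_k / h] is increasing to the right of the roots of [h]; hence if
   the sum of the [g_k] is positive on a half-line, so is one of them. *)
Lemma descent b P Y lam : well_blocked (b :: P) Y -> lam \is Num.real ->
  (forall x, lam <= x -> 0 < mixed T (fun=> x) (b :: P) Y) ->
  exists2 k, k \in b & forall x, lam <= x -> 0 < mixed T (fun=> x) P (k |: Y).
Proof.
move=> wb lr pos; have [b0 ub bY wbP] := well_blocked_cons wb.
have wbY : well_blocked P Y.
  by have := wbP finset.set0 (finset.sub0set _); rewrite finset.set0U.
have zc (x : C) : block_const P (fun=> x) by [].
pose h := mixed TX (fun=> 'X) P Y; pose D := (#|Y| + size P)%N.
have [sh hD] := size_coef_mixedX wbY; rewrite -/h -/D in sh hD.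
have hr : real_poly h by apply: real_poly_mixed => i; exact: real_polyX.
have hH x : 0 < 'Im x -> ~~ root h x.
  by move=> xH; rewrite /root horner_mixedX; apply: mixed_stable.
have [mu [mur hmu]] := real_rooted hr sh (lt0r_neq0 hD) hH.
set c := h`_D in hmu hD.
have hE x : h.[x] = c * \prod_l (x - mu l).
  rewrite hmu hornerZ horner_prod; congr (_ * _).
  by apply: eq_bigr => l _; rewrite !hornerE.
have gE k x : k \in b -> mixed T (fun=> x) P (k |: Y) =
    x * h.[x] + (mixed TX (upd (fun=> 'X) k 0) P (k |: Y)).[x].
  move=> /(allP bY)/andP[kY kP]; rewrite mixed_affine // horner_mixedX.
  congr (_ + _); rewrite horner_mixed; apply: eq_mixed => i _;
    by rewrite /upd; case: eqP; rewrite ?hornerX ?hornerC.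
(* Subtracting from [a *: h] the part of [g_k] other than ['X * h] cancels the top coefficient, and
   [mixed_quotient] supplies the sign required by [partial_fractions]. *)
have decomp k : k \in b -> exists a : C, exists u : 'I_D -> C,
    [/\ a \is Num.real, forall l, 0 <= u l & forall x,
      mixed T (fun=> x) P (k |: Y) = (x + a) * h.[x]
        - \sum_l u l * \prod_(m | m != l) (x - mu m)].
  move=> kb; have /andP[kY kP] := allP bY k kb.
  have wbk : well_blocked P (k |: Y) by apply: wbP; rewrite finset.sub1set inE.
  set E := mixed TX (upd (fun=> 'X) k 0) P (k |: Y).
  have Er : real_poly E.
    apply: real_poly_mixed => i; rewrite /upd; case: eqP => _; last exact: real_polyX.
    by rewrite /real_poly rmorph0.
  have sE : (size E <= D.+1)%N by apply: size_mixedX_upd.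
  pose a := E`_D / c.
  have ar : a \is Num.real.
    apply: rpredM; last by rewrite rpredV gtr0_real.
    by apply/CrealP; rewrite -coef_map /= Er.
  have [||x xH|u [u0 uE]] := @partial_fractions C D mu (a *: h - E) mur.
  - by rewrite /real_poly rmorphB /= map_polyZ /= hr Er conj_Creal.
  - apply/leq_sizeP => j; rewrite leq_eqVlt => /predU1P[<-|Dj].
      by rewrite coefB coefZ -/c divfK ?subrr // gt_eqF.
    rewrite coefB coefZ [E`_j]nth_default ?(leq_trans sE) //.
    by rewrite [h`_j]nth_default ?mulr0 ?subr0 // (leq_trans sh).
  - have p0 : \prod_l (x - mu l) != 0.
      by apply/prodf_neq0 => l _; exact: imaginary_neq.
    have -> : (a *: h - E).[x] / \prod_l (x - mu l) = a * c - c * (E.[x] / h.[x]).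
      rewrite hornerD hornerN hornerZ hE; field; by rewrite p0 gt_eqF.
    rewrite raddfB /=; have /Creal_ImP -> : a * c \is Num.real.
      by rewrite rpredM // gtr0_real.
    rewrite sub0r oppr_le0 ImMl ?gtr0_real // mulr_ge0 ?(ltW hD) //.
    have := @mixed_quotient C N T (fun=> x) P Y k hT wbk kY (zc x)
      (fun _ _ => xH) (fun _ _ => xH).
    rewrite -horner_mixedX -/h; congr (0 <= 'Im (_ / _)).
    by rewrite horner_mixed; apply: eq_mixed => i _;
      rewrite /upd; case: eqP; rewrite ?hornerX ?hornerC.
  exists a, u; split=> // x; rewrite gE //.
  have -> : E.[x] = a * h.[x] - (a *: h - E).[x].
    by rewrite hornerD hornerN hornerZ; ring.
  rewrite mulrDl uE horner_sum -!addrA; congr (_ + (_ - _)).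
  apply: eq_bigr => l _; rewrite hornerZ horner_prod; congr (_ * _).
  by apply: eq_bigr => m _; rewrite !hornerE.
(* At the largest root of [h] the term with [h] vanishes and the other products have nonnegative
   factors, so every [g_k] is nonpositive; such a point at or beyond [lam] contradicts [pos]. *)
have mulam l : mu l < lam.
  rewrite real_ltNge //; apply/negP => lmu.
  pose l1 := [arg max_(i > l) mu i]%O.
  have [mmax lmax] : (forall m, mu m <= mu l1) /\ lam <= mu l1.
    rewrite /l1; case: real_arg_maxP => // m _ mm; split=> [i|]; first exact: mm.
    by apply: le_trans lmu (mm _ _).
  have := pos _ lmax; rewrite /= big_seq; apply/negP; rewrite -real_leNgt ?real0 //.
    rewrite -oppr_ge0 -sumrN; apply: sumr_ge0 => k kb.
    have [a [u [ar u0 ->]]] := decomp k kb.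
    rewrite hE (bigD1 l1) //= subrr mul0r !mulr0 sub0r opprK.
    apply: sumr_ge0 => m _; rewrite mulr_ge0 //; apply: prodr_ge0 => i _.
    by rewrite subr_ge0.
  by apply: rpred_sum => i _; exact: mixed_real.
have hpos x : lam <= x -> 0 < h.[x].
  move=> lx; rewrite hE mulr_gt0 //; apply: prodr_gt0 => l _.
  by rewrite subr_gt0 (lt_le_trans (mulam l)).
have [k kb glam] : exists2 k, k \in b & 0 < mixed T (fun=> lam) P (k |: Y).
  apply/hasP; have := pos lam (lexx _); apply: contraTT => /hasPn nb.
  rewrite -real_leNgt ?real0 //; last exact: mixed_real.
  rewrite /= big_seq -oppr_ge0 -sumrN; apply: sumr_ge0 => k /nb.
  by rewrite oppr_ge0 -real_leNgt ?real0 //; exact: mixed_real.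
exists k => // x lx; have [a [u [ar u0 gk]]] := decomp k kb.
(* In this form the second factor is visibly increasing in [y], so its positivity at [lam]
   propagates. *)
have fE y : lam <= y -> mixed T (fun=> y) P (k |: Y) =
    h.[y] * (y + a - c^-1 * \sum_l u l / (y - mu l)).
  move=> ly; rewrite gk mulrBr [_ * h.[y]]mulrC; congr (_ - _).
  rewrite hE [c * _]mulrC -mulrA mulVKf ?gt_eqF // mulr_sumr.
  apply: eq_bigr => l _; rewrite mulrCA [X in _ = u l * (X / _)](bigD1 l) //=.
  by rewrite [(_ - mu l) * _]mulrC mulfK // gt_eqF // subr_gt0 (lt_le_trans (mulam l)).
rewrite fE // pmulr_rgt0 ?hpos //; move: glam; rewrite fE // pmulr_rgt0 ?hpos //.
move=> /lt_le_trans; apply; apply: lerB; first by rewrite lerD2r.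
rewrite ler_pM2l ?invr_gt0 //; apply: ler_sum => l _.
rewrite ler_wpM2l // lef_pV2 ?posrE ?subr_gt0 ?(lt_le_trans (mulam l)) //.
by rewrite lerD2r.
Qed.

Lemma selection P Y lam : well_blocked P Y -> lam \is Num.real ->
  (forall x, lam <= x -> 0 < mixed T (fun=> x) P Y) ->
  exists2 S : {set 'I_N}, {in P, forall b, exists2 k, k \in b & k \in S} &
    Y \subset S /\ forall x, lam <= x -> 0 < minor T (fun=> x) S.
Proof.
move=> + lr; elim: P Y => [|b P IH] Y wb pos; first by exists Y => //; split.
have [k kb kpos] := descent wb lr pos; have [b0 ub bY wbP] := well_blocked_cons wb.
have [|S PS [kS Spos]] := IH (k |: Y) _ kpos.
  by apply: wbP; rewrite finset.sub1set inE.
move: kS; rewrite finset.subUset finset.sub1set => /andP[kS YS].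
exists S; last by split.
by move=> c; rewrite inE => /predU1P[->|/PS//]; exists k.
Qed.

End Descent.

(** * From positive minors to a bound on the form *)

Section EigenvalueBound.
Variables (C : numClosedFieldType) (N : nat) (T : 'M[C]_N).
Hypothesis hT : hermitian_mx T.

Lemma qform_congruence (M : 'M[C]_N) (d : 'I_N -> C) (v : 'I_N -> C) :
  qform (\matrix_(i, j) \sum_k (M k i)^* * d k * M k j) v =
  \sum_k d k * `|\sum_j M k j * v j| ^+ 2.
Proof.
transitivity (\sum_k \sum_i \sum_j d k * ((M k i)^* * (v i)^* * (M k j * v j))).
  rewrite exchange_big /=; apply: eq_bigr => i _.
  rewrite exchange_big /=; apply: eq_bigr => j _.
  by rewrite mxE mulr_sumr mulr_suml; apply: eq_bigr => k _; ring.
apply: eq_bigr => k _; rewrite normCKC rmorph_sum mulr_suml mulr_sumr.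
apply: eq_bigr => i _; rewrite mulr_sumr mulr_sumr; apply: eq_bigr => j _.
by rewrite rmorphM.
Qed.

(** The compression of [T] to [S], padded with zeros, keeps the size [N]. An eigenvalue above [lam]
    is nonzero because [0 < lam], so its eigenvector is supported on [S] and makes the minor vanish
    there. *)
Lemma eigenvalue_bound (S : {set 'I_N}) lam : 0 < lam ->
  (forall x, lam <= x -> 0 < minor T (fun=> x) S) ->
  forall v, (forall i, i \notin S -> v i = 0) -> qform T v <= lam * sqnorm v.
Proof.
move=> lam0 pos v vS.
pose A : 'M[C]_N := \matrix_(i, j) (if (i \in S) && (j \in S) then T i j else 0).
have qA : qform T v = qform A v.
  apply: eq_bigr => i _; apply: eq_bigr => j _; rewrite mxE.
  have [iS|/vS ->] /= := boolP (i \in S); last by rewrite conjC0 !mul0r.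
  by have [//|/vS ->] := boolP (j \in S); rewrite !mulr0.
have hA : hermitian_mx A.
  apply/matrixP => i j; rewrite !mxE andbC; case: ifP => _; last by rewrite conjC0.
  by rewrite hermitianE.
have sA : A \is hermsymmx.
  apply/is_hermitianmxP; rewrite expr0 scale1r -map_trmx hA.
  by rewrite trmxK.
pose M := spectralmx A; pose d := spectral_diag A.
have Mu : M \is unitarymx by exact: spectral_unitarymx.
have /orthomx_spectralP AE := hermitian_normalmx sA.
rewrite invmx_unitary // -/M -/d in AE.
have dr k : d 0 k \is Num.real by have /mxOverP := hermitian_spectral_diag_real sA.
have AEe i j : A i j = \sum_k (M k i)^* * d 0 k * M k j.
  rewrite {1}AE -mulmxA mxE; apply: eq_bigr => k _.
  rewrite !mxE -mulrA; congr (_ * _); rewrite (bigD1 k) //= big1 => [|l lk].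
    by rewrite mxE eqxx mulr1n addr0.
  by rewrite mxE eq_sym (negPf lk) mulr0n mul0r.
have MV k l : \sum_j M k j * (M l j)^* = (k == l)%:R.
  have /matrixP/(_ k l) := unitarymxP Mu; rewrite !mxE => <-.
  by apply: eq_bigr => j _; rewrite !mxE.
have MU i j : \sum_k (M k i)^* * M k j = (i == j)%:R.
  have /matrixP/(_ i j) := mulmx1C (unitarymxP Mu); rewrite !mxE => <-.
  by apply: eq_bigr => k _; rewrite !mxE.
have nE : sqnorm v = \sum_k `|\sum_j M k j * v j| ^+ 2.
  have /= := qform_congruence M (fun=> 1) v.
  under [X in _ = X]eq_bigr => k _ do rewrite mul1r.
  move=> <-; apply: eq_bigr => i _.
  have e j : (\matrix_(i, j) \sum_k (M k i)^* * 1 * M k j) i j = (i == j)%:R.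
    by rewrite mxE -MU; apply: eq_bigr => k _; rewrite mulr1.
  under eq_bigr => j _ do rewrite e.
  rewrite (bigD1 i) //= big1 => [|j ji]; first by rewrite eqxx mulr1 addr0 normCKC.
  by rewrite eq_sym (negPf ji) mulr0 mul0r.
rewrite qA nE mulr_sumr.
have -> : qform A v = \sum_k d 0 k * `|\sum_j M k j * v j| ^+ 2.
  rewrite -qform_congruence; apply: eq_bigr => i _; apply: eq_bigr => j _.
  by rewrite AEe [in RHS]mxE.
apply: ler_sum => k _; rewrite ler_wpM2r ?exprn_ge0 // real_leNgt ?dr ?(gtr0_real lam0) //.
apply/negP => /ltW dk; have := pos _ dk.
suff -> : minor T (fun=> d 0 k) S = 0 by rewrite ltxx.
pose x : 'rV[C]_N := \row_j (M k j)^*.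
have d0 : d 0 k != 0 by rewrite gt_eqF // (lt_le_trans lam0).
have xE i : \sum_j A i j * x 0 j = d 0 k * x 0 i.
  transitivity (\sum_l (M l i)^* * d 0 l * (l == k)%:R).
    transitivity (\sum_j \sum_l (M l i)^* * d 0 l * (M l j * (M k j)^*)).
      apply: eq_bigr => j _; rewrite AEe mxE mulr_suml.
      by apply: eq_bigr => l _; rewrite mulrA.
    by rewrite exchange_big /=; apply: eq_bigr => l _; rewrite -mulr_sumr MV.
  rewrite (bigD1 k) //= big1 => [|l /negPf->]; last by rewrite mulr0.
  by rewrite eqxx mulr1 addr0 mulrC mxE.
have xS i : i \notin S -> x 0 i = 0.
  move=> iS; apply: (mulfI d0); rewrite -xE mulr0 big1 // => j _.
  by rewrite mxE (negPf iS) mul0r.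
apply/eqP; rewrite /minor -det_tr; apply/det0P; exists x.
  apply/eqP => x0; have := MV k k; rewrite big1 => [|j _].
    by rewrite eqxx => /esym/eqP; rewrite oner_eq0.
  by have /rowP/(_ j) := x0; rewrite !mxE => ->; rewrite mulr0.
apply/rowP => i; rewrite [RHS]mxE mxE; have [iS|iS] := boolP (i \in S).
  transitivity (\sum_j (x 0 j * (d 0 k *+ (i == j)) - A i j * x 0 j)).
    apply: eq_bigr => j _; rewrite [X in _ * X]mxE [X in _ * X]mxE iS mulrBr.
    congr (_ - _); rewrite [A i j]mxE iS /= mulrC.
    by case: ifPn => // /xS ->; rewrite !mulr0.
  rewrite sumrB xE (bigD1 i) //= big1 => [|j ji].
    by rewrite eqxx mulr1n addr0 mulrC subrr.
  by rewrite eq_sym (negPf ji) mulr0n mulr0.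
apply: big1 => j _; rewrite [X in _ * X]mxE [X in _ * X]mxE (negPf iS).
by case: eqP => [<-|_]; rewrite ?mulr0 // xS ?mul0r.
Qed.

End EigenvalueBound.

Section SelectionBound.
Variables (C : numClosedFieldType) (N : nat) (T : 'M[C]_N).

Lemma transversal_bound (w s : C) r (P : seq (seq 'I_N)) :
  hermitian_mx T -> w \is Num.real -> 0 < s ->
  (forall j v, (exists i, v i != 0) ->
    s * `|v j| ^+ 2 + qform T v < w * sqnorm v) ->
  (0 < r)%N -> all (fun b => size b == r) P -> uniq (flatten P) ->
  0 < w - shift r s ->
  exists2 S : {set 'I_N}, {in P, forall b, exists2 k, k \in b & k \in S} &
    forall v, (forall i, i \notin S -> v i = 0) ->
      qform T v <= (w - shift r s) * sqnorm v.
Proof.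
move=> hT wr s0 gapT r0 Pr uP lam0; set lam := w - shift r s.
have wb : well_blocked P (finset.set0 : {set 'I_N}).
  rewrite /well_blocked uP /=; apply/andP; split; apply/allP => b.
    by move=> /(allP Pr)/eqP ->.
  by rewrite inE.
have sr : shift r s \is Num.real.
  by rewrite rpredM ?rpredX ?rpredM ?rpredV ?realn // gtr0_real.
(* The gap hypothesis persists when [w] increases, so the barrier started at [x + shift r s] reaches
   every [x >= lam]. *)
have pos x : lam <= x -> 0 < mixed T (fun=> x) P finset.set0.
  move=> lx; have xr : x \is Num.real.
    exact: gtr0_real (lt_le_trans lam0 lx).
  have wr' : x + shift r s \is Num.real by rewrite rpredD.
  have wx : w <= x + shift r s by rewrite -lerBlDr.
  have gap' j v : (exists i, v i != 0) ->
      s * `|v j| ^+ 2 + qform T v < (x + shift r s) * sqnorm v.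
    move=> v0; apply: lt_le_trans (gapT j v v0) _.
    by rewrite ler_wpM2r // ltW // sqnorm_gt0.
  have [] // := barrier_all hT wr' s0 gap' Pr (Y := finset.set0) (z := fun=> x).
  + by move=> i; rewrite inE.
  + by move=> i _; rewrite addrK.
have [S PS [_ Spos]] := selection hT wb (gtr0_real lam0) pos.
by exists S => //; exact: eigenvalue_bound.
Qed.

End SelectionBound.

(** * Paving *)

Section Paving.
Variables (C : numClosedFieldType).

Lemma qformD n (T : 'M[C]_n) (x y : 'I_n -> C) : hermitian_mx T ->
  let b := \sum_i \sum_j (x i)^* * T i j * y j in
  qform T (fun i => x i + y i) = qform T x + qform T y + (b + b^*).
Proof.
move=> hT b; have -> : b^* = \sum_i \sum_j (y i)^* * T i j * x j.
  rewrite /b rmorph_sum exchange_big /=; apply: eq_bigr => j _.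
  rewrite rmorph_sum; apply: eq_bigr => i _ /=.
  by rewrite !rmorphM /= conjCK hermitianE //; ring.
rewrite /qform /b -!big_split /=; apply: eq_bigr => i _.
rewrite -!big_split /=; apply: eq_bigr => j _; rewrite rmorphD /=; ring.
Qed.

Lemma young (x y t : C) : 0 < t ->
  x * y + (x * y)^* <= `|x| ^+ 2 / t + t * `|y| ^+ 2.
Proof.
move=> t0; have tr : t^* = t by rewrite conj_Creal // gtr0_real.
rewrite -subr_ge0; have -> : `|x| ^+ 2 / t + t * `|y| ^+ 2 - (x * y + (x * y)^*)
    = `|x^* - t * y| ^+ 2 / t.
  rewrite !normCK rmorphB !rmorphM /= conjCK tr; field; by rewrite gt_eqF.
by rewrite divr_ge0 ?exprn_ge0 // ltW.
Qed.

(** Split off the coordinate [j]. Its own contribution vanishes with [T j j], and the cross terms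
    are balanced by [young]; a large [t] makes the coefficient at [j] as small as desired. *)
Lemma qform_split n (T : 'M[C]_n) (B t : C) j (u : 'I_n -> C) :
  hermitian_mx T -> 0 < t -> T j j = 0 ->
  (forall v, qform T v <= B * sqnorm v) -> \sum_i `|T j i| ^+ 2 <= B ->
  qform T u <= B / t * `|u j| ^+ 2 + (B + t) * (sqnorm u - `|u j| ^+ 2).
Proof.
move=> hT t0 Tj TB colB.
pose x i := if i == j then u j else 0; pose y i := if i == j then 0 else u i.
have uE i : u i = x i + y i.
  by rewrite /x /y; case: eqP => [->|_]; rewrite ?addr0 ?add0r.
have sy : sqnorm y = sqnorm u - `|u j| ^+ 2.
  rewrite /sqnorm (bigD1 j) //= [in RHS](bigD1 j) //= /y eqxx normr0 expr0n add0r.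
  by rewrite addrAC subrr add0r; apply: eq_bigr => i /negPf->.
have -> : qform T u = qform T (fun i => x i + y i).
  by apply: eq_bigr => i _; apply: eq_bigr => k _; rewrite -!uE.
rewrite qformD //; set b := (X in X + X^*).
have -> : qform T x = 0.
  rewrite /qform big1 // => i _; rewrite big1 // => k _; rewrite /x.
  case: eqP => [->|_]; last by rewrite conjC0 !mul0r.
  by case: eqP => [->|_]; rewrite ?mulr0 // Tj mulr0 mul0r.
have -> : b = \sum_k (u j)^* * T j k * y k.
  rewrite /b (bigD1 j) //= [X in _ + X]big1 ?addr0 => [|i ij].
    by rewrite /x eqxx.
  by rewrite big1 // => k _; rewrite /x (negPf ij) conjC0 !mul0r.
rewrite add0r addrC -sy.
have -> : B / t * `|u j| ^+ 2 + (B + t) * sqnorm y =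
  (B / t * `|u j| ^+ 2 + t * sqnorm y) + B * sqnorm y by ring.
apply: lerD; last exact: TB.
rewrite rmorph_sum -big_split /=.
apply: (@le_trans _ _ (\sum_i (`|(u j)^* * T j i| ^+ 2 / t + t * `|y i| ^+ 2))).
  by apply: ler_sum => i _; exact: young.
rewrite big_split /= -mulr_sumr lerD2r -mulr_suml [B / t]mulrC -mulrA mulrC.
rewrite ler_pM2l ?invr_gt0 //.
under eq_bigr => i _ do rewrite normrM exprMn norm_conjC.
by rewrite -mulr_sumr mulrC ler_wpM2r // exprn_ge0.
Qed.

Section Tensor.
Variables (n r : nat) (T : 'M[C]_n).
Let J : finType := ('I_n * 'I_r)%type.

(** The direct sum of [r] copies of [T]: the index [(i, k)] stands for giving the colour [k] to
    [i]. *)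
Definition tensor_id : 'M[C]_#|J| :=
  \matrix_(p, q) if (enum_val p).2 == (enum_val q).2
                 then T (enum_val p).1 (enum_val q).1 else 0.

Definition layer (v : 'I_#|J| -> C) k : 'I_n -> C := fun i => v (enum_rank (i, k)).

Lemma sum_tensor (F : 'I_#|J| -> C) :
  \sum_p F p = \sum_k \sum_i F (enum_rank (i, k)).
Proof.
rewrite (reindex (@enum_rank J)); last by apply: onW_bij; exact: enum_rank_bij.
rewrite exchange_big pair_big /=; apply: eq_bigr => -[i k] _; by [].
Qed.

Lemma sqnorm_tensor v : sqnorm v = \sum_k sqnorm (layer v k).
Proof. exact: sum_tensor. Qed.

Lemma qform_tensor v : qform tensor_id v = \sum_k qform T (layer v k).
Proof.
rewrite /qform sum_tensor; apply: eq_bigr => k _; apply: eq_bigr => i _.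
rewrite sum_tensor (bigD1 k) //= [X in _ + X]big1 ?addr0 => [|l lk].
  by apply: eq_bigr => j _; rewrite !mxE !enum_rankK /= eqxx.
apply: big1 => j _; rewrite !mxE !enum_rankK /= eq_sym (negPf lk).
by rewrite mulr0 mul0r.
Qed.

Lemma hermitian_tensor : hermitian_mx T -> hermitian_mx tensor_id.
Proof.
move=> hT; apply/matrixP => p q; rewrite !mxE eq_sym; case: ifP => _.
  by rewrite hermitianE.
by rewrite conjC0.
Qed.

End Tensor.

Lemma shift_le r (s : C) : 0 < s -> shift r s <= s.
Proof.
move=> s0; rewrite ler_piMr ?(ltW s0) // exprn_ile1 ?divr_ge0 ?ler0n //.
case: r => [|r]; first by rewrite mul0r ler01.
by rewrite ler_pdivrMr ?ltr0n // mul1r ler_nat.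
Qed.

Lemma shift_ge r (s : C) : (0 < r)%N -> 0 < s -> s - shift r s <= s *+ 2 / r%:R.
Proof.
move=> r0 s0; rewrite -subr_ge0.
have rE : r.-1%:R = r%:R - 1 :> C by rewrite -subn1 natrB.
have rn0 : r%:R != 0 :> C by rewrite pnatr_eq0 -lt0n.
have -> : s *+ 2 / r%:R - (s - shift r s) = s / r%:R ^+ 2.
  by rewrite /shift rE; field.
by rewrite divr_ge0 ?exprn_ge0 ?ler0n // ltW.
Qed.

Lemma paving n (T : 'M[C]_n) (B eps : C) r :
  hermitian_mx T -> 1 <= B -> 0 < eps -> eps < 1 -> (0 < r)%N ->
  B *+ 36 / eps ^+ 2 <= r%:R ->
  (forall i, T i i = 0) -> (forall v, qform T v <= B * sqnorm v) ->
  (forall j, \sum_i `|T j i| ^+ 2 <= B) ->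
  exists f : 'I_n -> 'I_r, forall k v, (forall i, f i != k -> v i = 0) ->
    qform T v <= eps * sqnorm v.
Proof.
move=> hT B1 e0 e1 r0 rB Td TB colB.
have B0 : 0 < B by apply: lt_le_trans B1.
have en0 : eps != 0 by rewrite gt_eqF.
have Bn0 : B != 0 by rewrite gt_eqF.
(* With this [t] one has [B / t = eps / 4], so [w - s = eps / 2]; the term [t *+ 2] in [w] leaves
   room for the coefficient [B + t] of [qform_split]. *)
pose t := B *+ 4 / eps; pose w := B + t *+ 2; pose s := w - B *+ 2 / t.
have t0 : 0 < t by rewrite divr_gt0 // pmulrn_lgt0.
have tn0 : t != 0 by rewrite gt_eqF.
have Bt : B / t = eps / 4 by rewrite /t; field; rewrite en0.
have eB : eps <= B by rewrite (le_trans (ltW e1)).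
have sE : s = t *+ 2 + (B - eps / 2).
  have B2t : B *+ 2 / t = eps / 2 by rewrite /t; field; rewrite en0.
  by rewrite /s /w B2t; ring.
have e2 : eps / 2 <= eps by rewrite ler_pdivrMr ?ltr0n // ler_peMr ?ltW // ltr1n.
have s0 : 0 < s.
  by rewrite sE ltr_pwDl ?pmulrn_lgt0 // subr_ge0 (le_trans e2).
have w0 : 0 < w by rewrite addr_gt0 // pmulrn_lgt0.
pose P : seq (seq 'I_#|{: 'I_n * 'I_r}|) :=
  [seq [seq enum_rank (i, k) | k <- enum 'I_r] | i <- enum 'I_n].
have t1 : eps <= t.
  apply: (le_trans (ltW e1)); rewrite ler_pdivlMr // mul1r (le_trans eB) //.
  by rewrite [B *+ 4]mulrS lerDl mulrn_wge0 // ltW.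
have BtB : B + t <= w - B / t.
  rewrite -subr_ge0; have -> : w - B / t - (B + t) = t - eps / 4.
    by rewrite /w Bt; ring.
  rewrite subr_ge0; apply: le_trans t1.
  by rewrite ler_pdivrMr ?ltr0n // ler_peMr ?ltW // ltr1n.
have BB : B <= w - B / t by apply: le_trans BtB; rewrite lerDl ltW.
(* The coefficient at [j] becomes [s + B / t = w - B / t]; the others, [B + t], do not exceed it. *)
have single j (u : 'I_n -> C) :
    s * `|u j| ^+ 2 + qform T u <= (w - B / t) * sqnorm u.
  have := qform_split u hT t0 (Td j) TB (colB j).
  rewrite -(lerD2l (s * `|u j| ^+ 2)) => /le_trans; apply.
  rewrite addrA -mulrDl; have -> : s + B / t = w - B / t by rewrite /s; field.
  have -> : (w - B / t) * sqnorm u = (w - B / t) * `|u j| ^+ 2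
    + (w - B / t) * (sqnorm u - `|u j| ^+ 2) by ring.
  rewrite lerD2l ler_wpM2r //.
  rewrite subr_ge0 /sqnorm (bigD1 j) //= lerDl.
  by apply: sumr_ge0 => i _; rewrite exprn_ge0.
have sw : s <= w by rewrite gerDl oppr_le0 divr_ge0 ?mulrn_wge0 // ltW.
have lam0 : 0 < w - shift r s.
  apply: lt_le_trans (_ : w - s <= _).
    by rewrite /s opprB addrC subrK divr_gt0 // pmulrn_lgt0.
  by rewrite lerD2l lerN2 shift_le.
(* One half of [eps] is [w - s]. The other half covers [s - shift r s <= 2 * s / r], as
   [s <= w <= 9 * B / eps] and [r >= 36 * B / eps ^+ 2]. *)
have lamE : w - shift r s <= eps.
  have -> : w - shift r s = eps / 2 + (s - shift r s).
    by rewrite sE /w; field.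
  have -> : eps = eps / 2 + eps / 2 by field.
  rewrite [X in X / 2 + _](_ : _ = eps); last by field.
  rewrite lerD2l; apply: (le_trans (shift_ge r0 s0)).
  rewrite ler_pdivrMr ?ltr0n //; apply: (@le_trans _ _ (B *+ 9 / eps *+ 2)).
    rewrite ler_pMn2r // (le_trans sw) // /w /t -subr_ge0.
    have -> : B *+ 9 / eps - (B + B *+ 4 / eps *+ 2) = B * (1 - eps) / eps by field.
    by rewrite divr_ge0 ?mulr_ge0 ?subr_ge0 // ltW.
  have -> : B *+ 9 / eps *+ 2 = eps / 2 * (B *+ 36 / eps ^+ 2) by field.
  by rewrite ler_wpM2l // divr_ge0 ?ler0n // ltW.
have [||||||||S PS SP] := @transversal_bound C _ (tensor_id r T) w s r P.
- exact: hermitian_tensor.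
- exact: gtr0_real.
- exact: s0.
- move=> p v v0; apply: (@le_lt_trans _ _ ((w - B / t) * sqnorm v)); last first.
    by rewrite ltr_pM2r ?sqnorm_gt0 // gtrDl oppr_lt0 divr_gt0.
  (* Only the layer containing [p] carries the term in [s]; for the others [B <= w - B / t]
     suffices. *)
  rewrite qform_tensor sqnorm_tensor mulr_sumr.
  rewrite (bigD1 (enum_val p).2) //= [leRHS](bigD1 (enum_val p).2) //= addrA.
  apply: lerD.
    have := single (enum_val p).1 (layer v (enum_val p).2).
    by rewrite /layer -surjective_pairing enum_valK.
  apply: ler_sum => k _; apply: (le_trans (TB _)); rewrite ler_wpM2r //.
  by apply: sumr_ge0 => i _; rewrite exprn_ge0.
- by [].
- by apply/allP => b /mapP[i _ ->]; rewrite size_map size_enum_ord.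
- apply: (@allpairs_uniq _ _ _ (fun i k => enum_rank (i, k))); rewrite ?enum_uniq //.
  by move=> [i k] [j l] _ _ /= /enum_rank_inj.
- by [].
have /fin_all_exists[f fS] i : exists k, enum_rank (i, k) \in S.
  have iP : [seq enum_rank (i, k) | k <- enum 'I_r] \in P.
    by apply/mapP; exists i; rewrite ?mem_enum.
  by have [_ /mapP[k _ ->] kS] := PS _ iP; exists k.
exists f => k v vk.
(* [v] placed in the layer [k] is supported on [S], since [f] takes the value [k] wherever [v] is
   nonzero. *)
pose v' (p : 'I_#|{: 'I_n * 'I_r}|) := if (enum_val p).2 == k then v (enum_val p).1 else 0.
have lk : layer v' k =1 v by move=> i; rewrite /layer /v' enum_rankK /= eqxx.
have ll l : l != k -> layer v' l =1 fun=> 0.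
  by move=> /negPf lk' i; rewrite /layer /v' enum_rankK /= lk'.
have v'S p : p \notin S -> v' p = 0.
  move=> pS; rewrite /v'; case: eqP => // pk; apply: vk; apply: contraNneq pS => fk.
  by have := fS (enum_val p).1; rewrite fk -pk -surjective_pairing enum_valK.
have := SP v' v'S; rewrite qform_tensor sqnorm_tensor.
have eq_qform (u1 u2 : 'I_n -> C) : u1 =1 u2 -> qform T u1 = qform T u2.
  by move=> u12; apply: eq_bigr => i _; apply: eq_bigr => j _; rewrite !u12.
have eq_sqnorm (u1 u2 : 'I_n -> C) : u1 =1 u2 -> sqnorm u1 = sqnorm u2.
  by move=> u12; apply: eq_bigr => i _; rewrite u12.
rewrite (bigD1 k) //= [X in _ + X]big1 => [|l lk']; last first.
  rewrite (eq_qform _ _ (ll l lk')) /qform big1 // => i _.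
  by rewrite big1 // => j _; rewrite mulr0.
rewrite (bigD1 k) //= [X in _ * (_ + X)]big1 => [|l lk']; last first.
  by rewrite (eq_sqnorm _ _ (ll l lk')) /sqnorm big1 // => i _; rewrite normr0 expr0n.
rewrite !addr0 (eq_qform _ _ lk) (eq_sqnorm _ _ lk) => /le_trans; apply.
by rewrite ler_wpM2r //; apply: sumr_ge0 => i _; rewrite exprn_ge0.
Qed.

(** This is a diagonal entry of [G ^+ 2 <= B *: G], obtained by testing [0 <= G] on the [j]-th basis
    vector minus [B^-1] times the [j]-th column of [G]. *)
Lemma column_bound n (G : 'M[C]_n) (B : C) j : hermitian_mx G -> 0 < B ->
  G j j = 1 -> (forall v, 0 <= qform G v <= B * sqnorm v) ->
  \sum_i `|G i j| ^+ 2 <= B.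
Proof.
move=> hG B0 Gj GB; set beta := \sum_i _; have Bn0 : B != 0 by rewrite gt_eqF.
have Br : B \is Num.real by rewrite gtr0_real.
pose x i : C := (i == j)%:R; pose y i := - (B^-1 * G i j).
have /andP[xy0 _] := GB (fun i => x i + y i).
have xE (F : 'I_n -> C) : \sum_i (x i)^* * F i = F j.
  rewrite (bigD1 j) //= big1 => [|i /negPf ij]; last by rewrite /x ij conjC0 mul0r.
  by rewrite /x eqxx conjC1 mul1r addr0.
have qx : qform G x = 1.
  rewrite /qform; under eq_bigr => i _ do under eq_bigr => k _ do rewrite -mulrA.
  under eq_bigr => i _ do rewrite -mulr_sumr.
  rewrite xE (bigD1 j) //= big1 => [|i /negPf ij]; last by rewrite /x ij mulr0.
  by rewrite /x eqxx mulr1 addr0 Gj.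
have sy : sqnorm y = B^-1 ^+ 2 * beta.
  rewrite /sqnorm mulr_sumr; apply: eq_bigr => i _.
  by rewrite normrN normrM exprMn ger0_norm // invr_ge0 ltW.
have /andP[_ qy] := GB y.
move: xy0; rewrite qformD // qx; set b := (X in X + X^*).
have bE : b = - (B^-1 * beta).
  rewrite /b; under eq_bigr => i _ do under eq_bigr => k _ do rewrite -mulrA.
  under eq_bigr => i _ do rewrite -mulr_sumr.
  rewrite xE /beta mulr_sumr -sumrN; apply: eq_bigr => i _.
  by rewrite /y mulrN mulrCA -(hermitianE j i hG) -normCK norm_conjC.
have betar : beta \is Num.real.
  by apply: rpred_sum => i _; rewrite rpredX // normr_real.
rewrite bE rmorphN rmorphM /= (conj_Creal betar) conj_Creal ?rpredV // => h.
have : 0 <= 1 + B * sqnorm y + (- (B^-1 * beta) + - (B^-1 * beta)).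
  by apply: le_trans h _; rewrite lerD2r lerD2l.
have -> : 1 + B * sqnorm y + (- (B^-1 * beta) + - (B^-1 * beta)) = (B - beta) / B.
  by rewrite sy; field.
by rewrite pmulr_lge0 ?invr_gt0 // subr_ge0.
Qed.

Lemma gram_paving n (G : 'M[C]_n) (B eps : C) r :
  hermitian_mx G -> 1 <= B -> 0 < eps -> eps < 1 -> (0 < r)%N ->
  B *+ 36 / eps ^+ 2 <= r%:R ->
  (forall i, G i i = 1) -> (forall v, 0 <= qform G v <= B * sqnorm v) ->
  exists f : 'I_n -> 'I_r * 'I_r, forall k v, (forall i, f i != k -> v i = 0) ->
    (1 - eps) * sqnorm v <= qform G v <= (1 + eps) * sqnorm v.
Proof.
move=> hG B1 e0 e1 r0 rB Gd GB; have B0 : 0 < B by apply: lt_le_trans B1.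
pose T : 'M[C]_n := \matrix_(i, j) (G i j - 1 *+ (i == j)).
have qT v : qform T v = qform G v - sqnorm v.
  by rewrite (qform_diag G (fun=> 1)); congr (_ - _); apply: eq_bigr => i _; rewrite mul1r.
have hT : hermitian_mx T.
  apply/matrixP => i j; rewrite !mxE rmorphB rmorphMn /= hermitianE // eq_sym.
  by rewrite conjC1.
have Td i : T i i = 0 by rewrite mxE eqxx Gd subrr.
have Tn i j : i != j -> T i j = G i j.
  by move=> /negPf ij; rewrite mxE ij subr0.
have colT j : \sum_i `|T j i| ^+ 2 <= B.
  apply: le_trans (column_bound hG B0 (Gd j) GB); apply: ler_sum => i _.
  rewrite -(hermitianE i j hT) norm_conjC; have [->|ij] := eqVneq i j.
    by rewrite Td normr0 expr0n exprn_ge0.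
  by rewrite Tn.
have sq0 (v : 'I_n -> C) : 0 <= sqnorm v.
  by apply: sumr_ge0 => i _; rewrite exprn_ge0.
have TB v : qform T v <= B * sqnorm v.
  by rewrite qT; apply: le_trans (proj2 (andP (GB v))); rewrite gerDl oppr_le0.
have qN v : qform (- T) v = - qform T v.
  rewrite /qform -sumrN; apply: eq_bigr => i _; rewrite -sumrN.
  by apply: eq_bigr => j _; rewrite mxE; ring.
have hN : hermitian_mx (- T).
  by rewrite /hermitian_mx map_mxN hT linearN.
have [f1 f1P] := paving hT B1 e0 e1 r0 rB Td TB colT.
have [|||f2 f2P] := paving hN B1 e0 e1 r0 rB.
- by move=> i; rewrite mxE Td oppr0.
(* The form of [1 - G] is at most the square norm because [G] is nonnegative, and [1 <= B]. *)
- move=> v; rewrite qN qT opprB; apply: (@le_trans _ _ (sqnorm v)).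
    by rewrite gerDl oppr_le0; have /andP[] := GB v.
  by rewrite ler_peMl.
- by move=> j; under eq_bigr => i _ do rewrite mxE normrN.
exists (fun i => (f1 i, f2 i)) => -[k1 k2] v vk.
have h1 := f1P k1 v _; have h2 := f2P k2 v _.
have {}h1 : qform T v <= eps * sqnorm v.
  by apply: h1 => i fk; apply: vk; apply: contra fk => /eqP[->].
have {}h2 : - qform T v <= eps * sqnorm v.
  by rewrite -qN; apply: h2 => i fk; apply: vk; apply: contra fk => /eqP[_ ->].
rewrite mulrBl mulrDl mul1r; move: h1 h2; rewrite qT => h1 h2; apply/andP; split.
  by rewrite lerBlDr -lerBlDl -opprB.
by rewrite -lerBlDl.
Qed.

End Paving.

(** * Passage to real and complex scalars *)

Section ScalarFields.

(** This follows [hilbert_dot], linear in its first argument; over a closed field it is [qform] of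
    the transpose. *)
Definition gform (K : numFieldType) (theta : K -> K) n (G : 'M[K]_n) (v : 'I_n -> K) : K :=
  \sum_i \sum_j v i * theta (v j) * G i j.

Definition sqsum (K : numFieldType) n (v : 'I_n -> K) : K := \sum_i `|v i| ^+ 2.

Definition gram_pavable (K : numFieldType) (theta : K -> K) (B eps : K) (r : nat) :=
  forall n (G : 'M[K]_n), (forall i j, G i j = theta (G j i)) ->
    (forall i, G i i = 1) ->
    (forall v, 0 <= gform theta G v <= B * sqsum v) ->
    exists f : 'I_n -> 'I_r * 'I_r, forall k v, (forall i, f i != k -> v i = 0) ->
      (1 - eps) * sqsum v <= gform theta G v <= (1 + eps) * sqsum v.

Lemma gram_pavable_conj (C : numClosedFieldType) (B eps : C) r :
  1 <= B -> 0 < eps -> eps < 1 -> (0 < r)%N -> B *+ 36 / eps ^+ 2 <= r%:R ->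
  gram_pavable Num.conj B eps r.
Proof.
move=> B1 e0 e1 r0 rB n G hG Gd GB.
have GE v : gform Num.conj G v = qform G^T v.
  rewrite /gform exchange_big /=; apply: eq_bigr => i _; apply: eq_bigr => j _.
  by rewrite mxE; ring.
have [|||f fP] := @gram_paving C n G^T B eps r _ B1 e0 e1 r0 rB.
- by apply/matrixP => i j; rewrite !mxE [RHS]hG.
- by move=> i; rewrite mxE.
- by move=> v; rewrite -GE; exact: GB.
by exists f => k v vk; rewrite GE; exact: (fP k v vk).
Qed.

(** Complexification: for a real symmetric [G] the form at a complex vector is the sum of the forms
    at its real and imaginary parts, so the hypotheses extend to complex vectors and the conclusion
    restricts to real ones. *)
Lemma gram_pavable_id (R : realType) (B eps : R) r :
  1 <= B -> 0 < eps -> eps < 1 -> (0 < r)%N -> B *+ 36 / eps ^+ 2 <= r%:R ->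
  gram_pavable idfun B eps r.
Proof.
move=> B1 e0 e1 r0 rB n G hG Gd GB.
pose c : {rmorphism R -> R[i]} := real_complex R; pose T := map_mx c G.
have hT : hermitian_mx T.
  by apply/matrixP => i j; rewrite !mxE [G j i]hG; exact: conjc_real.
have nc (x : R) : `|c x| ^+ 2 = c (`|x| ^+ 2).
  by rewrite -add_Re2_Im2 /= expr0n addr0 real_normK ?num_real.
have rn (x : R) : `|x| ^+ 2 = x ^+ 2 by rewrite real_normK ?num_real.
have sqc (v : 'I_n -> R) : sqnorm (c \o v) = c (sqsum v).
  by rewrite /sqsum rmorph_sum; apply: eq_bigr => i _; rewrite -nc.
have qc (v : 'I_n -> R) : qform T (c \o v) = c (gform idfun G v).
  rewrite /gform rmorph_sum; apply: eq_bigr => i _.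
  rewrite rmorph_sum; apply: eq_bigr => j _ /=.
  rewrite mxE !rmorphM /=; have -> : (c (v i))^* = c (v i) by exact: conjc_real.
  by ring.
pose re (v : 'I_n -> R[i]) i := complex.Re (v i); pose im (v : 'I_n -> R[i]) i := complex.Im (v i).
have sqv v : sqnorm v = c (sqsum (re v) + sqsum (im v)).
  rewrite /sqsum -big_split rmorph_sum /=; apply: eq_bigr => i _.
  by rewrite -add_Re2_Im2 !rn.
have qv v : qform T v = c (gform idfun G (re v) + gform idfun G (im v)).
  have vE i : v i = c (re v i) + 'i%R * c (im v i).
    by rewrite -complexiE; exact: complexE.
  have := @qformD R[i] n T (c \o re v) (fun i => 'i%R * c (im v i)) hT.
  set b := \sum_i _ => /= bE; transitivity (qform T (fun i => c (re v i) + 'i%R * c (im v i))).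
    by apply: eq_bigr => i _; apply: eq_bigr => j _; rewrite -!vE.
  rewrite bE qc.
  have -> : qform T (fun i => 'i%R * c (im v i)) = c (gform idfun G (im v)).
    rewrite -qc; apply: eq_bigr => i _; apply: eq_bigr => j _ /=.
    rewrite rmorphM /= conjCi.
    have -> : - 'i * (c (im v i))^* * T i j * ('i * c (im v j)) =
       - ('i ^+ 2) * ((c (im v i))^* * T i j * c (im v j)) by ring.
    by rewrite sqrCi opprK mul1r.
  (* The cross term is purely imaginary, so it cancels with its conjugate. *)
  rewrite rmorphD /=; suff -> : b + b^* = 0 by rewrite addr0.
  have [x ->] : exists x : R, b = 'i%R * c x.
    exists (\sum_i \sum_j re v i * G i j * im v j).
    rewrite rmorph_sum mulr_sumr; apply: eq_bigr => i _.
    rewrite rmorph_sum mulr_sumr; apply: eq_bigr => j _ /=.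
    rewrite mxE !rmorphM /=; have -> : (c (re v i))^* = c (re v i) by exact: conjc_real.
    by ring.
  rewrite rmorphM /= conjCi; have -> : (c x)^* = c x by exact: conjc_real.
  by ring.
have [|||||||f fP] := @gram_paving R[i] n T (c B) (c eps) r hT.
- by rewrite -(rmorph1 c) lecR.
- by rewrite -(rmorph0 c) ltcR.
- by rewrite -(rmorph1 c) ltcR.
- by [].
- by rewrite -rmorphXn -rmorphMn -fmorph_div /= -(rmorph_nat c) lecR.
- by move=> i; rewrite mxE Gd rmorph1.
- move=> v; rewrite qv sqv -rmorphM -(rmorph0 c) !lecR mulrDr.
  have /andP[h1 h2] := GB (re v); have /andP[h3 h4] := GB (im v).
  by rewrite addr_ge0 //= lerD.
exists f => k v vk; have := fP k (c \o v) _.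
rewrite qc sqc -(rmorph1 c) -rmorphB -rmorphD -!rmorphM !lecR; apply=> i fk /=.
by rewrite vk // rmorph0.
Qed.

End ScalarFields.

(** * Riesz sequences *)

Local Open Scope classical_set_scope.
Local Open Scope ring_scope.

#[local] Existing Instance totally_filter.

Section Sums.
Variables (K : numFieldType) (I : choiceType).

Lemma partial_sumE (W : zmodType) (x : I -> W) (J : {fset I}) :
  partial_sum x J = \sum_(i <- J) x i.
Proof. by rewrite /partial_sum big_seq_fsetE. Qed.

Lemma totally_superset (J : {fset I}) : totally [set J' : {fset I} | (J `<=` J')%fset].
Proof. by exists J. Qed.

Lemma has_sum_finite (W : normedModType K) (x : I -> W) (J : {fset I}) :
  (forall i, i \notin J -> x i = 0) -> has_sum x (partial_sum x J).
Proof.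
move=> x0; apply: cvg_near_cst; exists J => // J' /= JJ'.
by rewrite !partial_sumE; apply/esym/big_fset_incl => // i _; exact: x0.
Qed.

Lemma has_sum_unique (W : normedModType K) (x : I -> W) (s t : W) :
  has_sum x s -> has_sum x t -> s = t.
Proof. exact: (cvg_unique (@norm_hausdorff _ W)). Qed.

(** Uniform in the real and complex cases: [g] equals its norm, hence so does its limit. *)
Lemma cvg_ge0 (T : Type) (F : set_system T) (FF : ProperFilter F) (g : T -> K) (l : K) :
  (forall t, 0 <= g t) -> g @ F --> l -> 0 <= l.
Proof.
move=> g0 gl; have ngl : g @ F --> `|l|.
  have -> : g = (fun t => `|g t|) by apply/funext => t; rewrite ger0_norm.
  exact: cvg_norm gl.
by rewrite (cvg_unique (@norm_hausdorff _ K^o) gl ngl) normr_ge0.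
Qed.

Variable (V : completeNormedModType K).

Definition riesz_on (f : I -> V) (A B : K) (J : {fset I}) :=
  forall a : I -> K,
    A * (\sum_(i <- J) `|a i| ^+ 2) <= `|\sum_(i <- J) a i *: f i| ^+ 2
      <= B * (\sum_(i <- J) `|a i| ^+ 2).

Lemma riesz_on_of_riesz f A B J : riesz_basic_sequence f A B -> riesz_on f A B J.
Proof.
move=> [_ _ fAB] a; pose a' i := if i \in J then a i else 0.
have a'0 i : i \notin J -> a' i = 0 by rewrite /a' => /negPf->.
have a'E i : i \in J -> a' i = a i by rewrite /a' => ->.
have sE : \sum_(i <- J) `|a i| ^+ 2 = partial_sum (fun i => `|a' i| ^+ 2 : K^o) J.
  by rewrite partial_sumE !big_seq; apply: eq_bigr => i /a'E->.
have vE : \sum_(i <- J) a i *: f i = partial_sum (fun i => a' i *: f i) J.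
  by rewrite partial_sumE !big_seq; apply: eq_bigr => i /a'E->.
have [|v hv] := fAB a' (\sum_(i <- J) `|a i| ^+ 2).
  by rewrite sE; apply: has_sum_finite => i /a'0->; rewrite normr0 expr0n.
rewrite vE; suff -> : v = partial_sum (fun i => a' i *: f i) J by [].
apply: has_sum_unique hv _; apply: has_sum_finite => i /a'0->.
by rewrite scale0r.
Qed.

(** The upper bound on the difference of two finite sets makes the partial sums Cauchy as soon as
    the square sums converge; both inequalities then pass to the limit. *)
Lemma riesz_of_riesz_on f A B : 0 < A -> 0 < B ->
  (forall J, riesz_on f A B J) -> riesz_basic_sequence f A B.
Proof.
move=> A0 B0 fAB; split=> // a s hs.
pose S J := partial_sum (fun i => a i *: f i) J.
pose m (J : {fset I}) := \sum_(i <- J) `|a i| ^+ 2.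
have SE J : S J = \sum_(i <- J) a i *: f i by exact: partial_sumE.
have ms : m @ totally --> (s : K^o).
  have -> : m = partial_sum (fun i => `|a i| ^+ 2 : K^o).
    by apply/funext => J; rewrite partial_sumE.
  exact: hs.
have m0 J : 0 <= m J by apply: sumr_ge0 => i _; rewrite exprn_ge0.
have diff J J' : (J `<=` J')%fset ->
    `|S J - S J'| ^+ 2 <= B * (m J' - m J).
  move=> JJ'; pose D := (J' `\` J)%fset.
  have split (W : zmodType) (x : I -> W) :
      \sum_(i <- J') x i = \sum_(i <- J) x i + \sum_(i <- D) x i.
    rewrite (big_fsetID _ (fun i => i \in J)) /=; congr (_ + _).
      by apply: eq_fbigl => i; rewrite !inE /= andb_idl // => /(fsubsetP JJ').
    by apply: eq_fbigl => i; rewrite !inE /= andbC.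
  have -> : m J' - m J = \sum_(i <- D) `|a i| ^+ 2 by rewrite /m split addrAC subrr add0r.
  have -> : S J - S J' = - \sum_(i <- D) a i *: f i.
    by rewrite !SE split opprD addrA subrr add0r.
  by rewrite normrN; have /andP[] := fAB D a.
have cS : cauchy (S @ totally).
  apply: cauchy_exP => e e0.
  (* Two square sums within [h] of [s] differ by less than [e ^+ 2 / B]. *)
  pose h := e ^+ 2 / (B *+ 2).
  have h0 : 0 < h by rewrite divr_gt0 ?exprn_gt0 // pmulrn_lgt0.
  have := (cvgrPdist_lt _ _).1 ms h h0.
  move=> [J0 _ J0h]; exists (S J0); exists J0 => // J /= JJ0.
  rewrite -ball_normE /ball_ /=.
  rewrite -(ltr_pXn2r (ltn0Sn 1)) ?nnegrE ?normr_ge0 // ?(ltW e0) //.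
  apply: le_lt_trans (diff _ _ JJ0) _.
  have d0 : 0 <= m J - m J0.
    have := le_trans (exprn_ge0 2 (normr_ge0 (S J0 - S J))) (diff _ _ JJ0).
    by rewrite pmulr_rge0.
  rewrite mulrC -ltr_pdivlMr // -(ger0_norm d0).
  have -> : m J - m J0 = (s - m J0) - (s - m J) by ring.
  apply: le_lt_trans (ler_normB _ _) _.
  have -> : e ^+ 2 / B = h + h by rewrite /h; field; rewrite gt_eqF.
  apply: ltrD; first by apply: J0h => /=.
  exact: J0h.
have /cauchy_cvgP cvS := cS.
exists (lim (S @ totally)); first exact: cvS.
set v := lim _; have Sv : S @ totally --> v by exact: cvS.
have nSv : (fun J => `|S J| ^+ 2 : K^o) @ totally --> (`|v| ^+ 2 : K^o).
  by rewrite expr2; exact: cvgM (cvg_norm Sv) (cvg_norm Sv).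
apply/andP; split.
  rewrite -subr_ge0.
  apply: (@cvg_ge0 _ totally _ (fun J => `|S J| ^+ 2 - A * m J)).
    by move=> J; rewrite subr_ge0 SE; have /andP[] := fAB J a.
  apply: (@cvgB _ _ _ _ _ (fun J => `|S J| ^+ 2 : K^o) (fun J => A * m J : K^o)) => //.
  by apply: (@cvgM _ _ _ _ (fun=> A) m) => //; exact: cvg_cst.
rewrite -subr_ge0.
apply: (@cvg_ge0 _ totally _ (fun J => B * m J - `|S J| ^+ 2)).
  by move=> J; rewrite subr_ge0 SE; have /andP[] := fAB J a.
apply: (@cvgB _ _ _ _ _ (fun J => B * m J : K^o) (fun J => `|S J| ^+ 2 : K^o)) => //.
by apply: (@cvgM _ _ _ _ (fun=> B) m) => //; exact: cvg_cst.
Qed.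

End Sums.

(* Along an ultrafilter finer than [totally], the colour given to [i] by the
   colourings of the finite sets is eventually constant. *)
Lemma compact_coloring (I : choiceType) (Q : finType) (good : {fset I} -> Prop) :
  (forall J : {fset I}, exists c : I -> Q, forall J0 : {fset I}, (J0 `<=` J)%fset ->
     (exists k, forall i, i \in J0 -> c i = k) -> good J0) ->
  exists c : I -> Q, forall J : {fset I},
    (exists k, forall i, i \in J -> c i = k) -> good J.
Proof.
move=> /choice[col colP].
have [U [UU tU]] := ultraFilterLemma (@totally_filter I).
have PU : ProperFilter U by exact: ultra_proper.
have /choice[c cP] : forall i, exists q, U [set J | col J i = q].
  move=> i; apply: contrapT => /forallNP nq.
  have : U [set J | forall q, col J i <> q].
    apply: filter_forall => q.
    by have [/nq|] := in_ultra_setVsetC [set J | col J i = q] UU.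
  by move=> /filter_ex[J /(_ (col J i))].
exists c => J [k ck].
have UJ : U (\bigcap_(i in [set` J]) [set J' | col J' i = c i]).
  by apply: filter_bigI => i _; exact: cP.
have UJ' : U [set J' : {fset I} | (J `<=` J')%fset] by apply: tU; exact: totally_superset.
have [J' [cJ' JJ']] := filter_ex (filterI UJ UJ').
by apply: (colP J' J JJ'); exists k => i iJ; rewrite (cJ' i iJ) ck.
Qed.

(** * Colouring a Riesz sequence through its Gram matrices *)

Section Coloring.
Variables (K : numFieldType) (theta : {rmorphism K -> K}) (H : hilbertType theta).
Variables (I : choiceType) (f : I -> H) (B eps : K) (r : nat).
Hypotheses (f1 : unit_norm f) (r0 : (0 < r)%N).
Hypothesis fB : forall (J : {fset I}) (a : I -> K),
  `|\sum_(i <- J) a i *: f i| ^+ 2 <= B * \sum_(i <- J) `|a i| ^+ 2.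
(** Guarded by an element of [I]: paving relies on [1 <= B], which is deduced from a member of the
    family. *)
Hypothesis pav : I -> gram_pavable theta B eps r.

Lemma normsq_sum n (g : 'I_n -> H) (v : 'I_n -> K) :
  `|\sum_p v p *: g p| ^+ 2 =
  gform theta (\matrix_(p, q) hilbert_dot H (g p) (g q)) v.
Proof.
rewrite hilbert_normE linear_sumlz; apply: eq_bigr => p _.
rewrite linear_sumr; apply: eq_bigr => q _.
by rewrite linearZl_LR linearZr_LR /= mxE mulrA.
Qed.

Lemma gram_coloring (J : {fset I}) : exists c : I -> 'I_r * 'I_r,
  forall J0 : {fset I}, (J0 `<=` J)%fset -> (exists k, forall i, i \in J0 -> c i = k) ->
    riesz_on f (1 - eps) (1 + eps) J0.
Proof.
(* Default colour for the indices outside [J]. *)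
pose k0 : 'I_r * 'I_r := (Ordinal r0, Ordinal r0).
have [->|[i0 i0J]] := fset_0Vmem J.
  exists (fun=> k0) => J0; rewrite fsubset0 => /eqP-> _ a.
  by rewrite !big_seq_fset0 normr0 expr0n !mulr0 lexx.
pose n := size (enum_fset J); pose e (p : 'I_n) := tnth (in_tuple (enum_fset J)) p.
have eI : injective e by apply/tuple_uniqP; exact: fset_uniq.
have eJ p : e p \in J by rewrite mem_tnth.
have eS i : i \in J -> exists p, e p = i.
  by move=> iJ; have /tnthP[p ->] : i \in in_tuple (enum_fset J) by []; exists p.
pose ext (T : Type) (x0 : T) (v : 'I_n -> T) i := if [pick p | e p == i] is Some p then v p else x0.
have extE T (x0 : T) v p : ext T x0 v (e p) = v p.
  by rewrite /ext; case: pickP => [q /eqP/eI->|/(_ p)] //; rewrite eqxx.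
have sumE (W : zmodType) (x : I -> W) : \sum_(i <- J) x i = \sum_p x (e p).
  by rewrite big_tnth.
pose G := \matrix_(p, q) hilbert_dot H (f (e p)) (f (e q)).
have GE v : gform theta G v = `|\sum_p v p *: f (e p)| ^+ 2 by rewrite normsq_sum.
have [|||g gP] := pav i0 (G := G).
- by move=> p q; rewrite !mxE [LHS]hermC expr0 mul1r.
- by move=> p; rewrite mxE -hilbert_normE f1 expr1n.
- move=> v; rewrite GE exprn_ge0 //=; have := fB J (ext _ 0 v).
  have -> : \sum_(i <- J) ext K 0 v i *: f i = \sum_p v p *: f (e p).
    by rewrite sumE; apply: eq_bigr => p _; rewrite extE.
  suff -> : \sum_(i <- J) `|ext K 0 v i| ^+ 2 = sqsum v by [].
  by rewrite sumE; apply: eq_bigr => p _; rewrite extE.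
exists (ext _ k0 g) => J0 J0J [k ck] a.
pose v p := if e p \in J0 then a (e p) else 0.
have v0 p : g p != k -> v p = 0.
  by rewrite /v; case: ifP => // /ck; rewrite extE => ->; rewrite eqxx.
have := gP k v v0; rewrite GE.
have sub (W : zmodType) (x : I -> W) (y : 'I_n -> W) :
    (forall p, e p \in J0 -> y p = x (e p)) -> (forall p, e p \notin J0 -> y p = 0) ->
    \sum_p y p = \sum_(i <- J0) x i.
  move=> y1 y0; transitivity (\sum_(i <- J) if i \in J0 then x i else 0).
    rewrite sumE; apply: eq_bigr => p _.
    by case: ifPn => [/y1|/y0].
  rewrite -(big_fset_incl _ J0J); last by move=> i _ /negPf->.
  by rewrite !big_seq; apply: eq_bigr => i ->.
rewrite (sub _ (fun i => a i *: f i)); first last.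
- by move=> p /negPf pJ; rewrite /v pJ scale0r.
- by move=> p pJ; rewrite /v pJ.
rewrite /sqsum (sub _ (fun i => `|a i| ^+ 2)) //.
- by move=> p pJ; rewrite /v pJ.
- by move=> p /negPf pJ; rewrite /v pJ normr0 expr0n.
Qed.

Lemma union_of_gram_pavable R : (r * r <= R)%N -> 0 < eps -> eps < 1 ->
  union_of_eps_riesz f eps R.
Proof.
move=> rR e0 e1; have [c cP] := compact_coloring gram_coloring.
have card_le : (#|{: 'I_r * 'I_r}| <= R)%N by rewrite card_prod !card_ord.
(* Colours beyond the [r * r] pairs yield empty parts. *)
pose col i : 'I_R := widen_ord card_le (enum_rank (c i)).
have colI i j : col i = col j -> c i = c j.
  move=> /(congr1 val) /= h; apply: enum_rank_inj; exact: val_inj.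
exists (fun j => [set i | col i = j]); split.
- by move=> j1 j2 _ _ [i [/= <- <-]].
- by rewrite -subTset => i _; exists (col i).
move=> j; split=> [i|]; first exact: f1.
apply: riesz_of_riesz_on; rewrite ?subr_gt0 ?addr_gt0 // => J a.
pose J' : {fset I} := [fset val x | x in J]%fset.
pose a' i := if insub i is Some x then a x else 0.
have a'E x : a' (val x) = a x by rewrite /a' valK.
have sumE (W : zmodType) (y : I -> W) : \sum_(i <- J') y i = \sum_(x <- J) y (val x).
  by rewrite big_imfset //= => x1 x2 _ _; exact: val_inj.
have gJ' : riesz_on f (1 - eps) (1 + eps) J'.
  apply: cP; have [J0|[x0 x0J]] := fset_0Vmem J.
    by exists (Ordinal r0, Ordinal r0) => i /imfsetP[x /=]; rewrite J0 inE.
  exists (c (val x0)) => i /imfsetP[x /= xJ ->]; apply: colI.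
  by rewrite (set_valP x) (set_valP x0).
have := gJ' a'.
have -> : \sum_(i <- J') a' i *: f i = \sum_(x <- J) a x *: f (val x).
  by rewrite sumE; apply: eq_bigr => x _; rewrite a'E.
suff -> : \sum_(i <- J') `|a' i| ^+ 2 = \sum_(x <- J) `|a x| ^+ 2 by [].
by rewrite sumE; apply: eq_bigr => x _; rewrite a'E.
Qed.

End Coloring.

(** * Constants and conclusion *)

Lemma riesz_bound_ge1 (K : numFieldType) (V : completeNormedModType K)
    (I : choiceType) (f : I -> V) (A B : K) (i : I) :
  unit_norm f -> riesz_basic_sequence f A B -> 1 <= B.
Proof.
move=> f1 fAB; have /andP[_] := riesz_on_of_riesz [fset i]%fset fAB (fun=> 1).
by rewrite !big_seq_fset1 scale1r f1 normr1 expr1n mulr1.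
Qed.

Lemma exists_part_number (R : realType) (eps B : R) :
  0 < eps -> eps < 1 -> 0 < B -> exists r : nat,
    [/\ (0 < r)%N, B *+ 36 / eps ^+ 2 <= r%:R,
      (r * r <= `|Num.ceil ((6 * (B + 1) / eps) ^+ 4)|)%N &
      (r * r <= `|Num.ceil ((6 * (B + 1) / eps) ^+ 8)|)%N].
Proof.
move=> e0 e1 B0; set x := 6 * (B + 1) / eps.
have x1 : 1 <= x by rewrite /x ler_pdivlMr //; lra.
have x0 : 0 <= x by apply: le_trans x1.
(* Then [r * r <= x ^+ 4 <= x ^+ 8], as [1 <= x], so one [r] serves both kinds of scalars.
   Truncation costs at most 1, which the excess of [(B + 1) ^+ 2] over [B] absorbs. *)
pose r := Num.truncn (x ^+ 2); exists r.
have /andP[rx xr] := truncn_itv (exprn_ge0 2 x0).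
have r0 : (0 < r)%N by rewrite truncn_gt0 exprn_ege1.
have ceil_le (y : R) : x ^+ 4 <= y -> (r * r <= `|Num.ceil y|)%N.
  move=> xy; have y0 : 0 <= y by apply: le_trans xy; rewrite exprn_ge0.
  rewrite -(ler_nat R) natrM natr_absz ger0_norm; last first.
    by rewrite ceil_ge0 (lt_le_trans _ y0) // ltrN10.
  apply: le_trans (ceil_ge y); apply: le_trans xy.
  by rewrite -[4%N]/(2 + 2)%N exprD ler_pM ?ler0n.
split=> //; last 2 first.
- exact: ceil_le.
- by apply: ceil_le; rewrite ler_weXn2l.
have : x ^+ 2 - 1 <= r%:R.
  by move: (ltW xr); rewrite -/r -natr1; lra.
apply: le_trans; have en0 : eps != 0 by rewrite gt_eqF.
rewrite -subr_ge0.
have -> : x ^+ 2 - 1 - B *+ 36 / eps ^+ 2 = (36 * (B ^+ 2 + B + 1) - eps ^+ 2) / eps ^+ 2.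
  by rewrite /x; field.
by rewrite divr_ge0 ?exprn_ge0 ?ltW //; nra.
Qed.

Local Open Scope complex_scope.

Theorem theorem5p3 (R : realType) (eps B : R)
    (heps : 0 < eps < 1) (hB : 0 < B) :
  (forall (H : hilbertType (@idfun R)) (I : countType) (f : I -> H),
     unit_norm f -> (exists A : R, riesz_basic_sequence f A B) ->
     union_of_eps_riesz f eps `|Num.ceil ((6 * (B + 1) / eps) ^+ 4)|%N)
  /\
  (forall (H : hilbertType (@Num.conj R[i])) (I : countType) (f : I -> H),
     unit_norm f -> (exists A : R, riesz_basic_sequence f A%:C B%:C) ->
     union_of_eps_riesz f eps%:C `|Num.ceil ((6 * (B + 1) / eps) ^+ 8)|%N).
Proof.
have /andP[e0 e1] := heps.
have [r [r0 rB r4 r8]] := exists_part_number e0 e1 hB.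
split=> H I f f1 [A fAB].
  apply: (@union_of_gram_pavable R idfun H I f B eps r) => // [J a|i].
    by have /andP[] := riesz_on_of_riesz J fAB a.
  by apply: gram_pavable_id => //; exact: riesz_bound_ge1 i f1 fAB.
have ec0 : 0 < eps%:C by rewrite -(rmorph0 (real_complex R)) ltcR.
have ec1 : eps%:C < 1 by rewrite -(rmorph1 (real_complex R)) ltcR.
apply: (@union_of_gram_pavable R[i] Num.conj H I f B%:C eps%:C r) => //.
- by move=> J a; have /andP[] := riesz_on_of_riesz J fAB a.
- move=> i; apply: gram_pavable_conj => //.
  + exact: riesz_bound_ge1 i f1 fAB.
  + rewrite -(rmorph_nat (real_complex R)) -rmorphMn -rmorphXn -fmorph_div /=.
    by rewrite lecR.
Qed.
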